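(* Let $\mathcal{Z}\subset\mathbb{R}^n$ be closed, $f:\mathbb{R}^n\times\mathcal{Z}\to\mathbb{R}^n$ continuous, and $G:\mathcal{Z}\to\mathbb{S}^n_+$ a continuous metric. Let $z_0\in\mathcal{Z}$ and let $M,\nu,\mu,\alpha,\epsilon>0$ be such that $\|f(z,P_\mathcal{Z}(z))\|\le M$ and $\mu\mathbb{I}\preceq G^{-1}(P_\mathcal{Z}(z))\preceq\nu\mathbb{I}$ for all $z\in(z_0+\epsilon\mathbb{B})\cap\mathcal{Z}^\circ_\alpha$, and $\mathcal{Z}$ is $\alpha$-prox-regular at every $z\in(z_0+\epsilon\mathbb{B})\cap\mathcal{Z}$. Given any $T>0$, consider a sequence $K_n\to0^+$ and let $\{z_n\}$ be a sequence such that each $z_n$ is a $(T,\epsilon)$-truncated solution of the anti-windup approximation $$\dot z\in F_{K_n}(z):=f(z,P_\mathcal{Z}(z))-\tfrac{1}{K_n}G^{-1}(P_\mathcal{Z}(z))\big(z-P_\mathcal{Z}(z)\big)$$ with $z_n(0)=z_0$. Then there exists a subsequence of $\{z_n\}$ that converges graphically to a $(T,\epsilon)$-truncated solution of the projected dynamical system $\dot z=\Pi^G_\mathcal{Z}[\hat f](z)$, $z\in\mathcal{Z}$, where $\hat f(z):=f(z,P_\mathcal{Z}(z))$.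
   Context: $\mathbb{B}$ ($\operatorname{int}\mathbb{B}$) is the closed (open) unit ball; $\mathbb{S}^n_+$ is the set of symmetric positive definite $n\times n$ matrices; $\|u\|_{G(x)}:=(u^TG(x)u)^{1/2}$. $P_\mathcal{Z}(z):=\{\tilde z\in\mathcal{Z}:\|z-\tilde z\|=\inf_{y\in\mathcal{Z}}\|z-y\|\}$ (possibly set-valued); expressions containing $P_\mathcal{Z}(z)$ are understood as the sets obtained by ranging over $p\in P_\mathcal{Z}(z)$. $\mathcal{Z}^\circ_\alpha:=\mathcal{Z}+\tfrac{1}{2\alpha}\operatorname{int}\mathbb{B}$. Sets are assumed Clarke regular wherever tangent/normal cones are used. Tangent cone: $v\in T_x\mathcal{Z}$ iff there are $x_k\to x$, $x_k\in\mathcal{Z}$, $\delta_k\to0^+$ with $(x_k-x)/\delta_k\to v$; $\mathcal{Z}$ is Clarke regular if $x\mapsto T_x\mathcal{Z}$ is inner semicontinuous, and then the normal cone is $N_x\mathcal{Z}:=\{\eta:\langle\eta,v\rangle\le0\ \forall v\in T_x\mathcal{Z}\}$. $\mathcal{Z}$ is $\alpha$-prox-regular at $x\in\mathcal{Z}$ if every $\eta\in N_x\mathcal{Z}$ satisfies $\langle\eta,y-x\rangle\le\alpha\|\eta\|\|y-x\|^2$ for all $y\in\mathcal{Z}$. The projection operator is $\Pi^G_\mathcal{Z}[w](x):=\arg\min_{v\in T_x\mathcal{Z}}\|v-w\|_{G(x)}$ for $x\in\mathcal{Z}$, and $\Pi^G_\mathcal{Z}[\hat f](x):=\Pi^G_\mathcal{Z}[\hat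 f(x)](x)$. Solutions are Carathéodory: absolutely continuous maps satisfying the inclusion (and, for the projected system, $z(t)\in\mathcal{Z}$) for almost all $t$. A solution $x:[0,T']\to\mathbb{R}^n$ with $x(0)=x_0$ is $(T,\epsilon)$-truncated if $x(t)\in x_0+\epsilon\mathbb{B}$ for all $t\in[0,T']$ and either $T'=T$ or $\|x(T')-x_0\|=\epsilon$. A sequence of maps $z_i:[0,T_i]\to\mathbb{R}^n$ converges graphically if their graphs $\{(t,z_i(t))\}\subset\mathbb{R}\times\mathbb{R}^n$ converge as sets in the Painlevé–Kuratowski sense; the limit is the map whose graph is the limit set. *)

(* Defs.v *)
From HB Require Import structures.
From mathcomp Require Import all_boot all_order all_algebra.
From mathcomp Require Import all_classical all_reals all_analysis.
Set Implicit Arguments. Unset Strict Implicit. Unset Printing Implicit Defensive.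
Import Order.TTheory GRing.Theory Num.Theory.
Import numFieldNormedType.Exports.
Local Open Scope classical_set_scope.
Local Open Scope ring_scope.

Section Defs.
Context {R : realType} {n : nat}.
Local Notation vec := 'cV[R]_n.

Definition dotv (u v : vec) : R := \sum_(i < n) u i 0 * v i 0.
Definition enorm (u : vec) : R := Num.sqrt (dotv u u).
Definition qform (A : 'M[R]_n) (u : vec) : R := (u^T *m A *m u) 0 0.
Definition Gnorm (A : 'M[R]_n) (u : vec) : R := Num.sqrt (qform A u).

Definition spd (A : 'M[R]_n) : Prop :=
  A^T = A /\ forall u : vec, u != 0 -> 0 < qform A u.
Definition loewner_between (mu nu : R) (A : 'M[R]_n) : Prop :=
  forall u : vec, mu * enorm u ^+ 2 <= qform A u /\ qform A u <= nu * enorm u ^+ 2.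

Definition cball (x : vec) (r : R) : set vec := [set y | enorm (y - x) <= r].
Definition projZ (Z : set vec) (z : vec) : set vec :=
  [set p | Z p /\ forall y, Z y -> enorm (z - p) <= enorm (z - y)].
Definition Zalpha (Z : set vec) (alpha : R) : set vec :=
  [set z | exists y, Z y /\ enorm (z - y) < (2 * alpha)^-1].

Definition tangent_cone (Z : set vec) (x : vec) : set vec :=
  [set v | exists (xk : nat -> vec) (dk : nat -> R),
     (forall k, Z (xk k)) /\ (forall k, 0 < dk k) /\ dk @ \oo --> (0 : R) /\
     xk @ \oo --> x /\ (fun k => (dk k)^-1 *: (xk k - x)) @ \oo --> v].
(* Clarke regularity: x |-> T_x Z is inner semicontinuous on Z *)
Definition clarke_regular (Z : set vec) : Prop :=
  forall x, Z x -> forall v, tangent_cone Z x v ->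
  forall e : R, 0 < e -> exists d : R, 0 < d /\
  forall y, Z y -> enorm (y - x) < d ->
  exists w, tangent_cone Z y w /\ enorm (w - v) < e.
Definition normal_cone (Z : set vec) (x : vec) : set vec :=
  [set eta | forall v, tangent_cone Z x v -> dotv eta v <= 0].
Definition prox_regular_at (Z : set vec) (alpha : R) (x : vec) : Prop :=
  Z x /\ forall eta, normal_cone Z x eta -> forall y, Z y ->
    dotv eta (y - x) <= alpha * enorm eta * enorm (y - x) ^+ 2.

Definition proj_op (Z : set vec) (G : vec -> 'M[R]_n) (w x : vec) : set vec :=
  [set v | tangent_cone Z x v /\
     forall u, tangent_cone Z x u -> Gnorm (G x) (v - w) <= Gnorm (G x) (u - w)].

Definition abs_cont (a b : R) (z : R -> vec) : Prop :=
  forall e : R, 0 < e -> exists d : R, 0 < d /\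
  forall (k : nat) (l r : nat -> R),
    (forall i, (i < k)%N -> a <= l i /\ l i <= r i /\ r i <= b) ->
    (forall i j, (i < k)%N -> (j < k)%N -> i <> j -> r i <= l j \/ r j <= l i) ->
    \sum_(i < k) (r i - l i) < d ->
    \sum_(i < k) enorm (z (r i) - z (l i)) < e.

(* Caratheodory solution on [0,T'] of zdot \in F(z) (with an optional state
   constraint C, required to hold a.e. as well) *)
Definition cara_sol (C : set vec) (F : vec -> set vec) (T' : R) (z : R -> vec) : Prop :=
  abs_cont 0 T' z /\
  {ae (@lebesgue_measure R), forall t, t \in `[0, T'] ->
     derivable z t 1 /\ F (z t) ('D_1 z t) /\ C (z t)}.

Definition truncated_sol (T eps : R) (x0 : vec) (C : set vec) (F : vec -> set vec)
  (T' : R) (z : R -> vec) : Prop :=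
  0 <= T' /\ T' <= T /\ z 0 = x0 /\ cara_sol C F T' z /\
  (forall t, 0 <= t -> t <= T' -> enorm (z t - x0) <= eps) /\
  (T' = T \/ enorm (z T' - x0) = eps).

Definition anti_windup (Z : set vec) (f : vec -> vec -> vec) (G : vec -> 'M[R]_n)
  (K : R) (z : vec) : set vec :=
  [set v | exists p, projZ Z z p /\ v = f z p - K^-1 *: (invmx (G p) *m (z - p))].
Definition pds_rhs (Z : set vec) (f : vec -> vec -> vec) (G : vec -> 'M[R]_n)
  (z : vec) : set vec :=
  [set v | exists p, projZ Z z p /\ proj_op Z G (f z p) z v].

Definition graph (T' : R) (z : R -> vec) : set (R * vec) :=
  [set q | 0 <= q.1 /\ q.1 <= T' /\ q.2 = z q.1].
Definition pdist (q y : R * vec) : R := `|q.1 - y.1| + enorm (q.2 - y.2).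
Definition pk_liminf (C : nat -> set (R * vec)) : set (R * vec) :=
  [set q | forall e : R, 0 < e -> exists N, forall i, (N <= i)%N ->
     exists y, C i y /\ pdist q y < e].
Definition pk_limsup (C : nat -> set (R * vec)) : set (R * vec) :=
  [set q | forall e : R, 0 < e -> forall N, exists i, (N <= i)%N /\
     exists y, C i y /\ pdist q y < e].
Definition pk_conv (C : nat -> set (R * vec)) (L : set (R * vec)) : Prop :=
  pk_liminf C = L /\ pk_limsup C = L.

End Defs.

(* Main.v *)
Require Import Defs.
From HB Require Import structures.
From mathcomp Require Import all_boot all_order all_algebra.
From mathcomp Require Import all_classical all_reals all_analysis.
From mathcomp Require Import ring lra.
Set Implicit Arguments. Unset Strict Implicit. Unset Printing Implicit Defensive.
Import Order.TTheory GRing.Theory Num.Theory.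
Import numFieldNormedType.Exports.
Local Open Scope classical_set_scope.
Local Open Scope ring_scope.

(** Let p be a projection of z_n(t) on Z. The vector eta = (z_n - p)/K_n is a
    proximal normal to Z at p, and the distance from z_n to Z cannot grow beyond
    K_n M / mu, so |eta| <= M / mu; hence the z_n are equi-Lipschitz and a
    subsequence converges uniformly to a Lipschitz curve z in Z. Multiplying the
    equation by G(p) gives eta = G(p) (f(z_n, p) - z_n'), which is linear in the
    velocity. Given v in the tangent cone at z(t), Clarke regularity supplies
    tangent vectors at p close to v, so <G(p) (f(z_n, p) - z_n'), v> is almost
    nonpositive near t; integrating, letting n tend to infinity and
    differentiating yields <G(z) (f(z, z) - z'), v> <= 0. As z stays in Z, both
    z' and -z' are tangent, which makes z' the G-projection of f(z, z). *)

(** The velocities of the approximations converge at best weakly, and the projection [p] may be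
    multivalued and jump in time, so neither is followed to the limit. Each [p] is used at a single
    instant, and only scalar inequalities affine in the velocity, with coefficients frozen at one
    point of the limit curve, are passed on. No velocity is ever integrated: the working tool is
    that an absolutely continuous scalar whose upper right derivative is nonpositive almost
    everywhere cannot increase. The one-sided form suits the distance estimate, since the distance
    to [Z] along a curve may fail to be differentiable. Derivability of the limit curve, which
    [cara_sol] demands, comes from a Radon-Nikodym density. Tangency of both z' and -z' turns the
    normal inequality into the equality <G(z) (f(z, z) - z'), z'> = 0, and this gives the cross term
    a sign when z' is compared with another tangent vector in the G-norm. *)

(** * Monotonicity of absolutely continuous functions under an almost everywhere derivative bound *)

Section AbsolutelyContinuous.
Context {R : realType}.
Implicit Types (a b x y : R) (f : R -> R).
Local Notation leb := (@lebesgue_measure R).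

(** Induction on the reals: the supremum of the points up to which [P] holds throughout satisfies
    [P] by the left-limit hypothesis, and if it were below [b] the extension hypothesis would move
    it. *)
Lemma creeping_along (P : R -> Prop) a b : a <= b -> P a ->
  (forall x, a <= x -> x < b -> P x ->
     exists2 d, 0 < d & forall y, x < y -> y < x + d -> y <= b -> P y) ->
  (forall x, a < x -> x <= b -> (forall y, a <= y -> y < x -> P y) -> P x) ->
  P b.
Proof.
move=> ab Pa Pr Pl.
pose S := [set x | (a <= x <= b) /\ forall y, a <= y -> y <= x -> P y].
have Sa : S a.
  split; first by rewrite lexx.
  by move=> y ay ya; have -> : y = a by apply/eqP; rewrite eq_le ya ay.
have hS : has_sup S by split; [exists a | exists b => x [/andP[]]].
have aS : a <= sup S by apply: ub_le_sup => //; case: hS.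
have Sb : sup S <= b by apply: ge_sup; [exists a | move=> x [/andP[]]].
have Plt y : a <= y -> y < sup S -> P y.
  move=> ay yS; have [x [_ Sx] yx] := sup_gt (ex_intro _ a Sa) yS.
  by apply: Sx => //; apply: ltW.
have PS : P (sup S).
  by move: aS; rewrite le_eqVlt => /predU1P[<- //|aS]; apply: Pl.
have [bS|Slt] := leP b (sup S).
  by have -> : b = sup S by apply/eqP; rewrite eq_le bS Sb.
have [d d0 Pd] := Pr _ aS Slt PS.
pose x := Num.min b (sup S + d / 2).
have Sx : sup S < x by rewrite lt_min Slt ltrDl divr_gt0.
suff : S x by move=> /(ub_le_sup hS.2); rewrite leNgt Sx.
split; first by rewrite (le_trans aS (ltW Sx)) ge_min lexx.
move=> y ay yx; case: (ltgtP y (sup S)) => [yS|yS|->//]; first exact: Plt.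
apply: Pd => //.
  by apply: le_lt_trans yx _; rewrite gt_min ltrD2l; apply/orP; right; lra.
by apply: le_trans yx _; rewrite ge_min lexx.
Qed.

Definition disjoint_itvs a b (k : nat) (l r : nat -> R) :=
  (forall i, (i < k)%N -> a <= l i /\ l i <= r i /\ r i <= b) /\
  (forall i j, (i < k)%N -> (j < k)%N -> i <> j -> r i <= l j \/ r j <= l i).

Definition scalar_ac a b f := forall e : R, 0 < e -> exists2 d : R, 0 < d &
  forall (k : nat) (l r : nat -> R), disjoint_itvs a b k l r ->
    \sum_(i < k) (r i - l i) < d -> \sum_(i < k) `|f (r i) - f (l i)| < e.

(** An upper right Dini derivative is bounded instead of a derivative, because the main application
    is a clamped distance function, which has kinks. *)
Definition upper_right_deriv_le0 b f x := forall e : R, 0 < e ->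
  exists2 d : R, 0 < d &
    forall y, x < y -> y < x + d -> y <= b -> f y - f x <= e * (y - x).

Lemma scalar_ac_small a b f : scalar_ac a b f -> forall e : R, 0 < e ->
  exists2 d, 0 < d & forall x y, a <= x -> x <= y -> y <= b -> y - x < d ->
    `|f y - f x| < e.
Proof.
move=> acf e e0; have [d d0 fd] := acf e e0; exists d => // x y ax xy yb yxd.
have := fd 1%N (fun=> x) (fun=> y); rewrite !big_ord1; apply => //.
by split=> // [[|i] [|j]].
Qed.

Lemma disjoint_itvs_snoc a x y b k l r : disjoint_itvs a x k l r ->
  a <= x -> x <= y -> y <= b ->
  disjoint_itvs a y k.+1 (fun i => if (i < k)%N then l i else x)
                         (fun i => if (i < k)%N then r i else y).
Proof.
move=> [h1 h2] ax xy yb; split=> [i|i j]; rewrite ltnS leq_eqVlt.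
  case/predU1P => [->|ik]; first by rewrite ltnn.
  by rewrite ik; have [? [? ?]] := h1 _ ik; do !split => //; apply: le_trans xy.
case/predU1P => [->|ik]; rewrite ltnS leq_eqVlt.
  by case/predU1P => [->//|jk] _; rewrite ltnn jk; right; have [? []] := h1 _ jk.
case/predU1P => [->|jk] ij; first by rewrite ltnn ik; left; have [? []] := h1 _ ik.
by rewrite ik jk; apply: h2.
Qed.

(* Creep from a to b: right of a point where the derivative bound holds, f
   gains at most e per unit length; the null set of the other points is covered
   by an open U so small that the total variation of f along the steps inside
   U is at most e. *)
Lemma ac_nonincreasing a b f : a <= b -> scalar_ac a b f ->
  {ae leb, forall t, t \in `[a, b] -> upper_right_deriv_le0 b f t} ->
  f b <= f a.
Proof.
move=> ab acf [N [mN N0 subN]].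
have subN' t : ~ N t -> t \in `[a, b] -> upper_right_deriv_le0 b f t.
  by move=> Nt; apply: contrapT => h; apply: Nt; apply: subN.
apply/ler_addgt0Pr => e0 e0_gt0.
(* Budget: [e * (b - a)] for the slopes, one [e] for the variation along the steps inside the open
   cover, one [e] for the slack in [Q]. *)
pose e := e0 / (b - a + 2).
have ba2 : 0 < b - a + 2 by rewrite ltr_wpDl ?subr_ge0.
have e_gt0 : 0 < e by rewrite divr_gt0.
have -> : e0 = e * (b - a) + (e + e) by rewrite /e; field; rewrite gt_eqF.
have [d d0 fd] := acf e e_gt0.
have [|U [oU NU Ud]] := @lebesgue_regularity_outer R N d mN _ d0.
  by move: N0; rewrite /= => ->; exact: ltry.
have mU : measurable U by exact: measurable_realfun.open_measurable.
have {}Ud : (leb U < d%:E)%E.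
  rewrite (measureDI leb mU mN) setIC (setIidl NU).
  by move: N0; rewrite /= => ->; rewrite adde0.
have mI x : measurable (U `&` `[a, x]) by exact: measurableI.
(* The steps taken inside [U] have total length at most [m x], hence less than [d], however many
   there are; this is what lets absolute continuity be applied at the end. *)
pose m x := fine (leb (U `&` `[a, x])).
have fm x : leb (U `&` `[a, x]) \is a fin_num.
  rewrite ge0_fin_numE//; apply: le_lt_trans (ltry d); apply: ltW.
  apply: le_lt_trans Ud; apply: le_measure; rewrite ?inE; [exact: mI|exact: mU|by move=> z []].
have mle x y : x <= y -> m x <= m y.
  move=> xy; apply: fine_le => //; apply: le_measure; rewrite ?inE; [exact: mI|exact: mI|].
  by apply: setIS => z /=; rewrite !in_itv/= => /andP[-> zx]; apply: le_trans xy.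
have mstep x y : a <= x -> x <= y -> `[x, y] `<=` U -> m x + (y - x) <= m y.
  move=> ax xy xyU; rewrite -lee_fin EFinD !fineK//.
  have -> : (y - x)%:E = leb `]x, y].
    rewrite lebesgue_measure_itv/= lte_fin.
    case: (ltP x y) => [_|yx]; first by rewrite EFinB.
    have -> : y = x by apply/eqP; rewrite eq_le yx xy.
    by rewrite subrr.
  rewrite -measureU//; [|exact: mI|]; last first.
    apply/seteqP; split=> z //=; rewrite !in_itv/= => -[[_ /andP[_ zx]]].
    by rewrite ltNge zx.
  apply: le_measure; rewrite ?inE; [by apply: measurableU; [exact: mI|]|exact: mI|].
  move=> z /=; rewrite !in_itv/= => -[[Uz /andP[az zx]]|/andP[xz zy]].
    by split => //; rewrite az (le_trans zx).
  split; last by rewrite zy (le_trans ax (ltW xz)).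
  by apply: xyU; rewrite /= in_itv/= zy ltW.
have md x : m x < d.
  rewrite -lte_fin fineK//; apply: le_lt_trans Ud.
  by apply: le_measure; rewrite ?inE; [exact: mI|exact: mU|move=> z []].
(* The slack [e'] pays for left limits, where a list of intervals reaching only to some [y < x] is
   reused for [x]. Being arbitrary, it is halved at each such passage and does not accumulate. *)
pose Q (e' x : R) := exists k l r, [/\ disjoint_itvs a x k l r,
   \sum_(i < k) (r i - l i) <= m x &
   f x - f a <= e * (x - a) + \sum_(i < k) `|f (r i) - f (l i)| + e'].
suff : forall e', 0 < e' -> Q e' b.
  move=> /(_ e e_gt0)[k [l [r [dlr sm fb]]]].
  have := fd k l r dlr (le_lt_trans sm (md b)); lra.
apply: (@creeping_along (fun x => forall e', 0 < e' -> Q e' x) a b ab).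
- move=> e' e'0; exists 0%N, (fun=> 0), (fun=> 0); rewrite !big_ord0; split=> //.
  + exact: fine_ge0.
  + by rewrite !subrr mulr0 !add0r ltW.
- move=> x ax xb Px; have [Nx|Nx] := pselect (N x).
    have [d1 /= d10 xU] : nbhs_ball x U by apply/nbhs_ballP/open_nbhs_nbhs; split=> //; exact: NU.
    exists d1 => // y xy yd yb e' e'0; have [k [l [r [dlr sm fx]]]] := Px _ e'0.
    have xyU : `[x, y] `<=` U.
      move=> z /=; rewrite in_itv/= => /andP[xz zy]; apply: xU.
      by rewrite /ball/= distrC ger0_norm ?subr_ge0//; lra.
    exists k.+1, (fun i => if (i < k)%N then l i else x),
      (fun i => if (i < k)%N then r i else y).
    split; [exact: disjoint_itvs_snoc dlr ax (ltW xy) (lexx _)| |].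
      rewrite big_ord_recr/= ltnn; apply: le_trans (mstep _ _ ax (ltW xy) xyU).
      by rewrite lerD2r; under eq_bigr do rewrite ltn_ord.
    rewrite big_ord_recr/= ltnn; under eq_bigr do rewrite ltn_ord.
    have := ler_norm (f y - f x).
    have : 0 <= e * (y - x) by rewrite mulr_ge0 ?subr_ge0 ?ltW//.
    lra.
  have [|d1 d10 xd] := subN' _ Nx _ e e_gt0.
    by rewrite in_itv/= ax ltW.
  exists d1 => // y xy yd yb e' e'0; have [k [l [r [dlr sm fx]]]] := Px _ e'0.
  exists k, l, r; split.
  + split; last exact: dlr.2.
    by move=> i ik; have [? [? ?]] := dlr.1 _ ik; do !split => //; apply: le_trans (ltW xy).
  + exact: le_trans sm (mle _ _ (ltW xy)).
  + have := xd _ xy yd yb; lra.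
- move=> x ax xb Px e' e'0.
  have e'2 : 0 < e' / 2 by rewrite divr_gt0.
  have [d1 d10 fd1] := scalar_ac_small acf e'2.
  pose y := Num.max a (x - d1 / 2).
  have yx : y < x by rewrite gt_max ax /=; lra.
  have ay : a <= y by rewrite le_max lexx.
  have yd : x - y < d1.
    have : x - d1 / 2 <= y by rewrite le_max lexx orbT.
    lra.
  have [k [l [r [dlr sm fx]]]] := Px _ ay yx _ e'2.
  exists k, l, r; split.
  + split; last exact: dlr.2.
    by move=> i ik; have [? [? ?]] := dlr.1 _ ik; do !split => //; apply: le_trans (ltW yx).
  + exact: le_trans sm (mle _ _ (ltW yx)).
  + have := fd1 _ _ ay (ltW yx) xb yd.
    have := ler_norm (f x - f y).
    have : e * (y - a) <= e * (x - a) by apply: ler_wpM2l; rewrite ?lerD2r ltW.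
    lra.
Qed.

End AbsolutelyContinuous.

(** * Almost everywhere differentiability of real Lipschitz functions *)

Section LipschitzDifferentiable.
Context {R : realType}.
Local Notation leb := (@lebesgue_measure R).

Lemma lebesgue_stieltjes_measure_itvoc (F : cumulative R R) (x y : R) : x <= y ->
  lebesgue_stieltjes_measure F `]x, y] = (F y - F x)%:E.
Proof.
move=> xy.
have -> : lebesgue_stieltjes_measure F `]x, y] = wlength F `]x, y].
  rewrite /lebesgue_stieltjes_measure/= /measure_extension/=.
  by rewrite measurable_mu_extE//; exact: is_ocitv.
rewrite wlength_itv/= lte_fin; case: (ltP x y) => [_|yx]; first by rewrite EFinB.
have -> : y = x by apply/eqP; rewrite eq_le yx xy.
by rewrite subrr.
Qed.

Lemma lipschitz_continuous (L : R) (f : R -> R) :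
  (forall x y, x <= y -> `|f y - f x| <= L * (y - x)) -> continuous f.
Proof.
move=> fL x.
have L0 : 0 <= L by have := fL 0 1 ler01; rewrite subr0 mulr1; apply: le_trans.
have L1 : 0 < L + 1 by rewrite ltr_wpDl.
apply/cvgrPdist_lt => e e0; near=> y.
have xy : `|x - y| < e / (L + 1).
  near: y; apply: cvgr_dist_lt; [exact: cvg_id|by rewrite divr_gt0].
have : `|f x - f y| <= L * `|x - y|.
  have [xy'|/ltW yx] := leP x y.
    by rewrite distrC (distrC x) (ger0_norm (x := y - x)) ?subr_ge0//; exact: fL.
  by rewrite (ger0_norm (x := x - y)) ?subr_ge0//; exact: fL.
move: xy; rewrite ltr_pdivlMr// => xy h; apply: le_lt_trans h _.
have := normr_ge0 (x - y); lra.
Unshelve. all: by end_near. Qed.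

(* With slope at most 1/2, x/2 + f and x/2 - f are both nondecreasing and their
   Stieltjes measures add up to Lebesgue measure; hence the first is absolutely
   continuous and its density is the derivative of x/2 + f. *)
Section SlopeHalf.
Variables (f : R -> R).
Hypothesis fL : forall x y, x <= y -> `|f y - f x| <= 2^-1 * (y - x).

Let F1 x := 2^-1 * x + f x.
Let F2 x := 2^-1 * x - f x.

Let F1_nd : nondecreasing F1.
Proof. by move=> x y xy; have := fL xy; rewrite ler_norml /F1 => /andP[]; lra. Qed.
Let F2_nd : nondecreasing F2.
Proof. by move=> x y xy; have := fL xy; rewrite ler_norml /F2 => /andP[]; lra. Qed.
Let F1_rc : right_continuous F1.
Proof.
move=> x; apply: cvg_at_right_filter; apply: cvgD; last exact: (lipschitz_continuous fL).
by apply: cvgMr; exact: cvg_id.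
Qed.
Let F2_rc : right_continuous F2.
Proof.
move=> x; apply: cvg_at_right_filter; apply: cvgB; last exact: (lipschitz_continuous fL).
by apply: cvgMr; exact: cvg_id.
Qed.

HB.instance Definition _ := isCumulative.Build R _ R F1 F1_nd F1_rc.
HB.instance Definition _ := isCumulative.Build R _ R F2 F2_nd F2_rc.

Let nu1 := lebesgue_stieltjes_measure F1.
Let nu2 := lebesgue_stieltjes_measure F2.

Let leb_sum A : measurable A -> leb A = (nu1 A + nu2 A)%E.
Proof.
rewrite -[RHS](measure_addE nu1 nu2); apply: lebesgue_measure_unique.
move=> X [[x y] /= _ <-]; have [xy|/ltW yx] := leP x y; last first.
  by rewrite set_itv_ge ?bnd_simp -?leNgt// !measure0.
apply: etrans (esym (measure_addE nu1 nu2 _)).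
have -> : leb `]x, y] = (y - x)%:E := lebesgue_stieltjes_measure_itvoc idfun xy.
have h1 : nu1 `]x, y] = (F1 y - F1 x)%:E := lebesgue_stieltjes_measure_itvoc _ xy.
have h2 : nu2 `]x, y] = (F2 y - F2 x)%:E := lebesgue_stieltjes_measure_itvoc _ xy.
apply: etrans (esym (congr2 adde h1 h2)).
by apply: (etrans _ (EFinD _ _)); congr EFin; rewrite /F1 /F2; lra.
Qed.

Lemma half_lipschitz_derivable_ae (a b : R) : a < b ->
  {ae leb, forall t, a < t < b -> derivable f t 1}.
Proof.
move=> ab.
have mab : measurable (`]a, b] : set (measurableTypeR R)) by [].
have fin : (nu1 `]a, b] < +oo)%E.
  by rewrite /nu1 lebesgue_stieltjes_measure_itvoc ?ltry// ltW.
pose nu : {finite_measure set (measurableTypeR R) -> \bar R} := @mfrestr _ (measurableTypeR R) R _ nu1 mab fin.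
(* [leb_sum] exhibits [nu1] as one of two nonnegative summands of Lebesgue measure, so it vanishes
   on Lebesgue null sets. *)
have dom : nu `<< leb.
  apply/null_content_dominatesP => A mA A0.
  have : leb (A `&` `]a, b]) = 0%E.
    apply/eqP; rewrite eq_le measure_ge0 andbT -A0.
    apply: le_measure; rewrite ?inE; [exact: measurableI|exact: mA|by move=> z []].
  rewrite leb_sum; last exact: measurableI.
  by move=> /eqP; rewrite padde_eq0 ?measure_ge0// => /andP[/eqP + _].
pose g := Radon_Nikodym_SigmaFinite.f nu leb.
have ig : leb.-integrable setT g := Radon_Nikodym_SigmaFinite.f_integrable dom.
have gfin := Radon_Nikodym_SigmaFinite.f_fin_num dom.
have gE : g = EFin \o (fine \o g) by apply/funext => x /=; rewrite fineK// gfin.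
have lg : locally_integrable [set: R] (fine \o g).
  apply: open_integrable_locally; first exact: openT. by have := ig; rewrite {1}gE.
have gi y : leb.-integrable [set` Interval (BRight a) (BRight y)] (EFin \o (fine \o g)).
  by have := ig; rewrite {1}gE; apply: integrableS.
(* The indefinite integral of the density is derivable at almost every point; near such a [t] it
   differs from [F1] by the constant [F1 a]. *)
have := FTC1 gi lg; apply: filterS; first exact: (ae_filter_ringOfSetsType leb).
move=> t /= h /andP[at_ tb]; have [dg _] := h at_.
have -> : f = (fun x => F1 x - 2^-1 * x) by apply/funext => x; rewrite /F1; lra.
apply: derivableB; last first.
  by apply: derivableM.
have F1E : {near t, F1 =1 (fun x => F1 a + \int[leb]_(s in `]a, x]) (fine \o g) s)}.
  near=> x.
  have ax : a < x by near: x; exact: lt_nbhsr.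
  have xb : x < b by near: x; exact: lt_nbhsl.
  rewrite /Rintegral (_ : (fun s => _) = g); last by rewrite [RHS]gE.
  rewrite -(Radon_Nikodym_SigmaFinite.f_integral dom)//.
  have -> : nu `]a, x]%classic = nu1 (`]a, x]%classic `&` `]a, b]%classic) by [].
  rewrite setIidl; last by apply: subset_itvl; rewrite bnd_simp ltW.
  have -> : nu1 `]a, x] = (F1 x - F1 a)%:E := lebesgue_stieltjes_measure_itvoc _ (ltW ax).
  by rewrite /= addrC subrK.
apply: (near_eq_derivable (f := fun x => F1 a + \int[leb]_(s in `]a, x]) (fine \o g) s)).
  by apply: filterS F1E => x ->.
by apply: derivableD.
Unshelve. all: by end_near. Qed.

End SlopeHalf.

Lemma lipschitz_derivable_ae (L : R) (f : R -> R) (a b : R) : 0 < L -> a < b ->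
  (forall x y, x <= y -> `|f y - f x| <= L * (y - x)) ->
  {ae leb, forall t, a < t < b -> derivable f t 1}.
Proof.
move=> L0 ab fL; pose g x := (2 * L)^-1 * f x.
have gL x y : x <= y -> `|g y - g x| <= 2^-1 * (y - x).
  move=> xy; rewrite -mulrBr normrM gtr0_norm ?invr_gt0 ?mulr_gt0//.
  rewrite invfM -mulrA ler_wpM2l ?invr_ge0// mulrC ler_pdivrMr// mulrC.
  exact: fL.
have := half_lipschitz_derivable_ae gL ab; apply: filterS; first exact: (ae_filter_ringOfSetsType leb).
move=> t gt tab.
have -> : f = (2 * L) \*o g.
  by apply/funext => x /=; rewrite /g mulrA divff ?mul1r// gt_eqF// mulr_gt0.
by apply: derivableM => //; apply: gt.
Qed.

End LipschitzDifferentiable.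

(** * Euclidean inner product, comparison of norms, matrix bounds *)

Section Euclidean.
Context {R : realType} {n : nat}.
Implicit Types (u v w : 'cV[R]_n) (A : 'M[R]_n).

Lemma dotvE u v : dotv u v = (u^T *m v) 0 0.
Proof. by rewrite mxE; apply: eq_bigr => i _; rewrite mxE. Qed.

Lemma dotvC u v : dotv u v = dotv v u.
Proof. by apply: eq_bigr => i _; rewrite mulrC. Qed.

Lemma dotvDl u v w : dotv (u + v) w = dotv u w + dotv v w.
Proof. by rewrite !dotvE linearD mulmxDl mxE. Qed.

Lemma dotvNl u v : dotv (- u) v = - dotv u v.
Proof. by rewrite !dotvE linearN mulNmx mxE. Qed.

Lemma dotvBl u v w : dotv (u - v) w = dotv u w - dotv v w.
Proof. by rewrite dotvDl dotvNl. Qed.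

Lemma dotvZl (c : R) u v : dotv (c *: u) v = c * dotv u v.
Proof. by rewrite !dotvE linearZ -scalemxAl mxE. Qed.

Lemma dotvDr u v w : dotv u (v + w) = dotv u v + dotv u w.
Proof. by rewrite !(dotvC u) dotvDl. Qed.

Lemma dotvNr u v : dotv u (- v) = - dotv u v.
Proof. by rewrite !(dotvC u) dotvNl. Qed.

Lemma dotvBr u v w : dotv u (v - w) = dotv u v - dotv u w.
Proof. by rewrite dotvDr dotvNr. Qed.

Lemma dotvZr (c : R) u v : dotv u (c *: v) = c * dotv u v.
Proof. by rewrite !(dotvC u) dotvZl. Qed.

Lemma dotv_symmetric A u v : A^T = A -> dotv (A *m u) v = dotv u (A *m v).
Proof. by move=> sA; rewrite !dotvE trmx_mul sA mulmxA. Qed.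

Lemma dotv_qform A u : dotv u (A *m u) = qform A u.
Proof. by rewrite dotvE mulmxA. Qed.

Lemma dotvv_ge0 u : 0 <= dotv u u.
Proof. by apply: sumr_ge0 => i _; rewrite -expr2 sqr_ge0. Qed.

Lemma enorm_ge0 u : 0 <= enorm u.
Proof. exact: sqrtr_ge0. Qed.

Lemma enorm_sqr u : enorm u ^+ 2 = dotv u u.
Proof. by rewrite sqr_sqrtr// dotvv_ge0. Qed.

Lemma enorm0 : enorm (0 : 'cV[R]_n) = 0.
Proof. by rewrite /enorm /dotv big1 ?sqrtr0// => i _; rewrite mxE mul0r. Qed.

Lemma enormN u : enorm (- u) = enorm u.
Proof. by rewrite /enorm dotvNl dotvNr opprK. Qed.

Lemma enormBC u v : enorm (u - v) = enorm (v - u).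
Proof. by rewrite -enormN opprB. Qed.

Lemma enormZ (c : R) u : enorm (c *: u) = `|c| * enorm u.
Proof.
by rewrite /enorm dotvZl dotvZr mulrA -expr2 sqrtrM ?sqr_ge0// sqrtr_sqr.
Qed.

Lemma normr_coord_le_enorm u i : `|u i 0| <= enorm u.
Proof.
rewrite -sqrtr_sqr ler_wsqrtr// /dotv (bigD1 i)//= -expr2 lerDl.
by apply: sumr_ge0 => j _; rewrite -expr2 sqr_ge0.
Qed.

Lemma enorm_eq0 u : enorm u = 0 -> u = 0.
Proof.
move=> u0; apply/colP => i; rewrite mxE; apply/eqP.
by rewrite -normr_le0 -u0 normr_coord_le_enorm.
Qed.

Lemma dotv_le u v : dotv u v <= enorm u * enorm v.
Proof.
have := enorm_ge0 u; rewrite le_eqVlt => /predU1P[/esym/enorm_eq0 ->|u0].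
  by rewrite enorm0 mul0r /dotv big1// => i _; rewrite mxE mul0r.
have := enorm_ge0 v; rewrite le_eqVlt => /predU1P[/esym/enorm_eq0 ->|v0].
  by rewrite enorm0 mulr0 /dotv big1// => i _; rewrite mxE mulr0.
have uv0 : 0 < enorm u * enorm v by rewrite mulr_gt0.
(* With a = |u|, b = |v| and c = <u, v>, this square equals 2ab(ab - c), whence c <= ab. *)
have := dotvv_ge0 (enorm v *: u - enorm u *: v).
rewrite dotvBl !dotvBr !dotvZl !dotvZr -!enorm_sqr (dotvC v u).
set a := enorm u in u0 uv0 *; set b := enorm v in v0 uv0 *; set c := dotv _ _.
rewrite [X in 0 <= X](_ : _ = (a * b) * (2 * (a * b - c))); last by ring.
by rewrite pmulr_rge0// pmulr_rge0// subr_ge0.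
Qed.

Lemma normr_dotv_le u v : `|dotv u v| <= enorm u * enorm v.
Proof.
rewrite ler_norml dotv_le andbT lerNl -dotvNl.
by apply: le_trans (dotv_le _ _) _; rewrite enormN.
Qed.

Lemma enormD u v : enorm (u + v) <= enorm u + enorm v.
Proof.
rewrite -(@ler_pXn2r _ 2)// ?nnegrE ?addr_ge0 ?enorm_ge0//.
rewrite enorm_sqr dotvDl !dotvDr (dotvC v u) sqrrD -!enorm_sqr mulr2n.
have := dotv_le u v; lra.
Qed.

Lemma enormB_triangle v u w : enorm (u - w) <= enorm (u - v) + enorm (v - w).
Proof. by apply: le_trans (enormD _ _); rewrite addrA subrK. Qed.

(** The norm [|u|] behind the topology of matrices is the maximum of the entries; this lemma and the
    next ones translate between it and [enorm], at the price of a factor [n]. *)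
Lemma normr_le_coord u (c : R) : 0 <= c -> (forall i, `|u i 0| <= c) -> `|u| <= c.
Proof.
move=> c0 uc; rewrite /Num.norm/= mx_normrE; apply/bigmax_leP; split=> //.
by move=> [i j] _ /=; rewrite ord1.
Qed.

Lemma normr_le_enorm u : `|u| <= enorm u.
Proof.
apply: normr_le_coord; first exact: enorm_ge0.
by move=> i; rewrite normr_coord_le_enorm.
Qed.

Lemma coord_le_normr u i : `|u i 0| <= `|u|.
Proof.
rewrite [leRHS]/Num.norm /= mx_normrE; apply/bigmax_geP; right => /=.
by exists (i, 0).
Qed.

Lemma enorm_le_normr u : enorm u <= n%:R * `|u|.
Proof.
rewrite -(@ler_pXn2r _ 2)// ?nnegrE ?mulr_ge0 ?enorm_ge0//.
rewrite enorm_sqr.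
apply: (@le_trans _ _ (\sum_(i < n) `|u| ^+ 2)).
  apply: ler_sum => i _; rewrite -expr2 -real_normK ?num_real//.
  by rewrite lerXn2r ?nnegrE// coord_le_normr.
rewrite sumr_const card_ord -[leLHS]mulr_natl exprMn ler_wpM2r ?sqr_ge0//.
by rewrite -natrX ler_nat; case: (n) => // k; rewrite expnS expn1 leq_pmulr.
Qed.

Lemma enorm_mulmx_le A u (c : R) : 0 <= c -> (forall i j, `|A i j| <= c) ->
  enorm (A *m u) <= n%:R * (n%:R * c * enorm u).
Proof.
move=> c0 Ac; apply: le_trans (enorm_le_normr _) _; rewrite ler_wpM2l//.
apply: normr_le_coord; first by rewrite !mulr_ge0// enorm_ge0.
move=> i; rewrite mxE; apply: le_trans (ler_norm_sum _ _ _) _.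
apply: (@le_trans _ _ (\sum_(j < n) (c * enorm u))).
  by apply: ler_sum => j _; rewrite normrM ler_pM// normr_coord_le_enorm.
by rewrite sumr_const card_ord -[leLHS]mulr_natl mulrA.
Qed.

Lemma coord_dotv u i : u i 0 = dotv (delta_mx i 0) u.
Proof.
rewrite /dotv (bigD1 i)//= mxE !eqxx mul1r big1 ?addr0// => j /negPf ji.
by rewrite mxE ji mul0r.
Qed.

Lemma spd_unitmx A : spd A -> A \in unitmx.
Proof.
move=> [sA pA]; rewrite -row_free_unit -kermx_eq0; apply/eqP/row_matrixP => i.
apply/eqP; rewrite row0; apply: contraT => k0.
(* A nonzero row of the left kernel is a nonzero vector on which the quadratic form vanishes. *)
pose u := (row i (kermx A))^T.
have u0 : u != 0 by apply: contra k0 => /eqP/(congr1 trmx); rewrite trmxK trmx0 => ->.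
have := pA u u0; rewrite /qform trmxK -row_mul mulmx_ker row0 mul0mx mxE.
by rewrite ltxx.
Qed.

Lemma qformD A u v : A^T = A ->
  qform A (u + v) = qform A u + 2 * dotv u (A *m v) + qform A v.
Proof.
move=> sA; rewrite -!dotv_qform mulmxDr dotvDr !dotvDl (dotvC v (A *m u)).
by rewrite (dotv_symmetric u v sA); ring.
Qed.

(** Polarisation replaces eigenvalues: with e_i a basis vector, 2<e_i, Au> = q(e_i + u) - q(e_i) -
    q(u), where the subtracted values are nonnegative and the first is at most 2 nu (1 + |u|^2). The
    bound is not sharp; any bound uniform in [A] serves. *)
Lemma enorm_mulmx_loewner A u (mu nu : R) : A^T = A -> 0 < nu -> 0 <= mu ->
  loewner_between mu nu A ->
  enorm (A *m u) <= n%:R * (nu * (1 + enorm u ^+ 2)).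
Proof.
move=> sA nu0 mu0 h; apply: le_trans (enorm_le_normr _) _; rewrite ler_wpM2l//.
apply: normr_le_coord; first by rewrite mulr_ge0 ?addr_ge0 ?sqr_ge0 ?ltW.
have q0 w : 0 <= qform A w.
  by apply: le_trans (h w).1; rewrite mulr_ge0// sqr_ge0.
have e1 i : enorm (delta_mx i 0 : 'cV[R]_n) ^+ 2 = 1.
  by rewrite enorm_sqr -coord_dotv mxE !eqxx.
have bnd w i : 2 * dotv (delta_mx i 0) (A *m w) <= 2 * (nu * (1 + enorm w ^+ 2)).
  have := qformD (delta_mx i 0) w sA; have := (h (delta_mx i 0 + w)).2.
  have := q0 (delta_mx i 0); have := q0 w.
  have : enorm (delta_mx i 0 + w) ^+ 2 <= 2 * (1 + enorm w ^+ 2).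
    have := e1 i; have := sqr_ge0 (enorm (delta_mx i 0 - w)).
    rewrite !enorm_sqr !dotvDl !dotvDr !dotvNl !dotvNr; lra.
  by rewrite -(ler_pM2l nu0); lra.
move=> i; rewrite coord_dotv ler_norml; apply/andP; split.
  have := bnd (- u) i; rewrite mulmxN dotvNr enormN; lra.
have := bnd u i; lra.
Qed.

End Euclidean.

(** * Mean value inequalities for absolutely continuous curves *)

Section AbsolutelyContinuousCurves.
Context {R : realType} {n : nat}.
Implicit Types (z : R -> 'cV[R]_n) (a b c t s : R).
Local Notation leb := (@lebesgue_measure R).

(** Closes the epsilon arguments below. The restriction [e <= 1] lets higher-order errors be
    absorbed in a constant [B] independent of [e]. *)
Lemma le0_of_le_mul c B : (forall e, 0 < e -> e <= 1 -> c <= e * B) -> c <= 0.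
Proof.
move=> h; rewrite leNgt; apply/negP => c0.
pose B' := Num.max B c.
have B0 : 0 < B' by rewrite lt_max c0 orbT.
have e0 : 0 < c / (2 * B') by rewrite divr_gt0 ?mulr_gt0.
have := h _ e0; rewrite ler_pdivrMr ?mulr_gt0// mul1r.
have cB : c <= B' by rewrite le_max lexx orbT.
move=> /(_ _)/wrap[|]; first lra.
have -> : c / (2 * B') * B = c / 2 * (B / B') by field; rewrite gt_eqF.
have : B / B' <= 1 by rewrite ler_pdivrMr// mul1r le_max lexx.
have c2 : 0 < c / 2 by rewrite divr_gt0.
by rewrite -(ler_pM2l c2); lra.
Qed.

Lemma cvg_enorm (T : Type) (F : set_system T) {FF : Filter F}
    (x : T -> 'cV[R]_n) (y : 'cV[R]_n) :
  x @ F --> y <-> forall e, 0 < e -> \forall k \near F, enorm (x k - y) < e.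
Proof.
split=> [xy e e0|h].
  have e1 : 0 < e / (n%:R + 1) by rewrite divr_gt0 ?ltr_wpDl.
  move/cvgrPdist_lt: xy => /(_ _ e1); apply: filterS => k.
  rewrite ltr_pdivlMr ?ltr_wpDl// => yx.
  apply: le_lt_trans (enorm_le_normr _) _; rewrite distrC.
  by apply: le_lt_trans yx; rewrite mulrC ler_wpM2l// lerDl.
apply/cvgrPdist_lt => e e0; apply: filterS (h e e0) => k.
by apply: le_lt_trans; rewrite distrC normr_le_enorm.
Qed.

Lemma derivable_expansion z t : derivable z t 1 -> forall e, 0 < e ->
  exists2 d, 0 < d & forall s, `|s - t| < d ->
    enorm (z s - z t - (s - t) *: 'D_1 z t) <= e * `|s - t|.
Proof.
move=> dz e e0.
have /cvg_enorm/(_ _ e0) : h^-1 *: (z (h *: 1 + t) - z t) @[h --> 0^'] --> 'D_1 z t.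
  exact: dz.
move=> [d /= d0 hd]; exists d => // s st.
have [->|s0] := eqVneq s t.
  by rewrite !subrr scale0r subr0 enorm0 normr0 mulr0.
have st0 : s - t != 0 by rewrite subr_eq0.
have := hd (s - t); rewrite /ball_/= sub0r normrN => /(_ st st0).
rewrite /= [(_ - t) *: 1]mulr1 subrK => h.
rewrite [X in enorm X](_ : _ = (s - t) *: ((s - t)^-1 *: (z s - z t) - 'D_1 z t)).
  by rewrite enormZ mulrC ler_wpM2r// ltW.
by rewrite scalerBr scalerA divff// scale1r.
Qed.

Lemma abs_cont_comp z T a b (h : R -> R) C C' : abs_cont 0 T z -> 0 <= a -> b <= T ->
  0 <= C -> 0 <= C' ->
  (forall x y, a <= x -> x <= y -> y <= b ->
     `|h y - h x| <= C * enorm (z y - z x) + C' * (y - x)) ->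
  scalar_ac a b h.
Proof.
move=> acz a0 bT C0 C'0 hz e e0.
have eC : 0 < e / (2 * (C + 1)) by rewrite divr_gt0 ?mulr_gt0 ?ltr_wpDl.
have eC' : 0 < e / (2 * (C' + 1)) by rewrite divr_gt0 ?mulr_gt0 ?ltr_wpDl.
have [d [d0 zd]] := acz _ eC.
exists (Num.min d (e / (2 * (C' + 1)))); first by rewrite lt_min d0.
move=> k l r [lr dlr]; rewrite lt_min => /andP[sd se].
have := zd k l r _ dlr sd => /(_ _)/wrap[i ik|].
  by have [? [? ?]] := lr i ik; do !split => //; [exact: le_trans a0 _|exact: le_trans bT].
rewrite ltr_pdivlMr ?mulr_gt0 ?ltr_wpDl// => sz.
move: se; rewrite ltr_pdivlMr ?mulr_gt0 ?ltr_wpDl// => se.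
apply: (@le_lt_trans _ _ (C * \sum_(i < k) enorm (z (r i) - z (l i)) + C' * \sum_(i < k) (r i - l i))).
  rewrite !mulr_sumr -big_split/=; apply: ler_sum => i _.
  by have [? [? ?]] := lr i (ltn_ord i); apply: hz.
have : 0 <= \sum_(i < k) enorm (z (r i) - z (l i)) by apply: sumr_ge0 => i _; exact: enorm_ge0.
have : 0 <= \sum_(i < k) (r i - l i).
  by apply: sumr_ge0 => i _; rewrite subr_ge0; have [? []] := lr i (ltn_ord i).
lra.
Qed.

(** Does the work of integrating <w, z'> <= c: the scalar <w, z(t)> - c t is absolutely continuous
    with nonpositive upper right derivative almost everywhere. *)
Lemma abs_cont_dotv_le z T a b c (w : 'cV[R]_n) :
  abs_cont 0 T z -> 0 <= a -> a <= b -> b <= T ->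
  {ae leb, forall t, a <= t -> t <= b -> derivable z t 1 /\ dotv w ('D_1 z t) <= c} ->
  dotv w (z b - z a) <= c * (b - a).
Proof.
move=> acz a0 ab bT dz.
suff : dotv w (z b) - c * b <= dotv w (z a) - c * a by rewrite dotvBr; lra.
apply: (ac_nonincreasing (f := fun t => dotv w (z t) - c * t) ab).
  apply: (abs_cont_comp (C := enorm w) (C' := `|c|) acz a0 bT) => //.
    exact: enorm_ge0.
  move=> x y ax xy yb.
  rewrite [X in `|X|](_ : _ = dotv w (z y - z x) - c * (y - x)); last first.
    by rewrite dotvBr; ring.
  apply: le_trans (ler_normB _ _) _; rewrite lerD ?normr_dotv_le//.
  by rewrite normrM (ger0_norm (x := y - x)) ?subr_ge0.
apply: filterS dz; first exact: (ae_filter_ringOfSetsType leb).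
move=> t /= h; rewrite in_itv/= => /andP[at_ tb] e e0.
have [dt dc] := h at_ tb.
have e1 : 0 < e / (enorm w + 1) by rewrite divr_gt0 ?ltr_wpDl ?enorm_ge0.
have [d d0 zd] := derivable_expansion dt e1; exists d => // s ts sd _.
have st0 : 0 <= s - t by rewrite subr_ge0 ltW.
have := zd s; rewrite (ger0_norm st0); set q := _ - _ *: _ => /(_ _)/wrap[|qe].
  by lra.
have -> : dotv w (z s) - c * s - (dotv w (z t) - c * t) =
   dotv w q + (s - t) * (dotv w ('D_1 z t) - c).
  by rewrite /q !dotvBr dotvZr; ring.
have := dotv_le w q.
have : enorm w * enorm q <= e * (s - t).
  apply: (@le_trans _ _ (enorm w * (e / (enorm w + 1) * (s - t)))).
    by rewrite ler_wpM2l ?enorm_ge0.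
  rewrite mulrA ler_wpM2r// mulrCA ger_pMr//.
  by rewrite ler_pdivrMr ?ltr_wpDl ?enorm_ge0// mul1r lerDl.
have : (s - t) * (dotv w ('D_1 z t) - c) <= 0.
  by rewrite mulr_ge0_le0// subr_le0.
lra.
Qed.

(** Testing against the increment w = z(t) - z(s) itself gives |w|^2 <= |w| L (t - s), and one
    factor |w| cancels. *)
Lemma abs_cont_lipschitz z T (L : R) : 0 <= L ->
  abs_cont 0 T z ->
  {ae leb, forall t, t \in `[0, T] -> derivable z t 1 /\ enorm ('D_1 z t) <= L} ->
  forall s t, 0 <= s -> s <= t -> t <= T -> enorm (z t - z s) <= L * (t - s).
Proof.
move=> L0 acz dz s t s0 st tT; set w := z t - z s.
have : dotv w w <= (enorm w * L) * (t - s).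
  apply: (abs_cont_dotv_le acz s0 st tT).
  apply: filterS dz; first exact: (ae_filter_ringOfSetsType leb).
  move=> r /= h sr rt; have [|dr Lr] := h; first by rewrite in_itv/= (le_trans s0 sr) (le_trans rt tT).
  by split=> //; apply: le_trans (dotv_le _ _) _; rewrite ler_wpM2l ?enorm_ge0.
rewrite -enorm_sqr -mulrA; have := enorm_ge0 w.
rewrite le_eqVlt => /predU1P[<- _|w0]; last by rewrite expr2 ler_pM2l.
by rewrite mulr_ge0// subr_ge0.
Qed.

End AbsolutelyContinuousCurves.

(** * Distance to a set and proximal normals *)

Section Distance.
Context {R : realType} {n : nat}.
Variable Z : set 'cV[R]_n.
Implicit Types x y z p v : 'cV[R]_n.

Definition setdist z : R := inf [set enorm (z - y) | y in Z].

Let has_lb_dist z : has_lbound [set enorm (z - y) | y in Z].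
Proof. by exists 0 => _ [y _ <-]; exact: enorm_ge0. Qed.

Lemma setdist_le z y : Z y -> setdist z <= enorm (z - y).
Proof. by move=> Zy; apply: ge_inf => //; exists y. Qed.

Lemma setdist_lt z e : Z !=set0 -> setdist z < e -> exists2 y, Z y & enorm (z - y) < e.
Proof.
move=> [y0 Zy0] /inf_lt[|_ [y Zy <-] ye]; last by exists y.
by exists (enorm (z - y0)), y0.
Qed.

Lemma setdist_projZ z p : projZ Z z p -> setdist z = enorm (z - p).
Proof.
move=> [Zp zp]; apply/eqP; rewrite eq_le setdist_le//=.
by apply: lb_le_inf; [exists (enorm (z - p)), p | move=> _ [y Zy <-]; exact: zp].
Qed.

Lemma setdist_lipschitz z w : Z !=set0 -> setdist z <= setdist w + enorm (z - w).
Proof.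
move=> Z0; apply/ler_addgt0Pr => e e0.
have [|y Zy wy] := @setdist_lt w (setdist w + e) Z0; first by rewrite ltrDl.
have := setdist_le z Zy; have := enormB_triangle w z y; lra.
Qed.

Lemma setdist_closed z : closed Z -> Z !=set0 -> setdist z <= 0 -> Z z.
Proof.
move=> cZ Z0 z0; apply: cZ => B /nbhs_ballP[e /= e0 eB].
have [|y Zy zy] := @setdist_lt z e Z0; first exact: le_lt_trans z0 e0.
exists y; split=> //; apply: eB; rewrite -ball_normE /=.
exact: le_lt_trans (normr_le_enorm _) zy.
Qed.

Lemma projZ_self z : Z z -> projZ Z z z.
Proof. by move=> Zz; split=> // y _; rewrite subrr enorm0 enorm_ge0. Qed.

(** Write a point of [Z] near [p] as p + d q with q close to the tangent vector v. Minimality of |z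
    - p| gives 2 <z - p, q> <= d |q|^2, which vanishes with d. In [B], the first term pays for
    replacing q by v, the second for d |q|^2 / 2. *)
Lemma projZ_normal z p : projZ Z z p -> normal_cone Z p (z - p).
Proof.
move=> [Zp zp] v [xk [dk [Zxk [dk0 [dk_0 [_ cv]]]]]].
have [r rE] : exists r, r = z - p by exists (z - p).
rewrite -rE; pose B := enorm r + (enorm v + 1) ^+ 2 / 2.
apply: (@le0_of_le_mul _ _ B) => e e0 e1.
have /cvg_enorm/(_ _ e0) := cv => -[N1 _ h1].
have /cvgrPdist_lt/(_ _ e0) := dk_0 => -[N2 _ h2].
pose k := maxn N1 N2.
have {h1} := h1 k (leq_maxl _ _); have {h2} := h2 k (leq_maxr _ _).
rewrite /= sub0r normrN gtr0_norm//; set q := _ *: _ => dke qv.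
have xE : xk k = p + dk k *: q.
  by rewrite /q scalerA divff ?gt_eqF// scale1r addrC subrK.
clearbody q; have := zp _ (Zxk k); rewrite -(@ler_pXn2r _ 2)// ?nnegrE ?enorm_ge0//.
rewrite !enorm_sqr xE opprD addrA -rE.
rewrite dotvBl !dotvBr !dotvZl !dotvZr (dotvC q r) -(enorm_sqr q) => h.
have {}h : 2 * dotv r q <= dk k * enorm q ^+ 2.
  by rewrite -(ler_pM2l (dk0 k)); lra.
have qb : enorm q <= enorm v + 1.
  have := enormD (q - v) v; rewrite subrK; lra.
have q2 : dk k * enorm q ^+ 2 <= e * (enorm v + 1) ^+ 2.
  apply: ler_pM; [exact: ltW|exact: sqr_ge0|exact: ltW|].
  by rewrite lerXn2r ?nnegrE ?enorm_ge0// addr_ge0 ?enorm_ge0.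
have -> : dotv r v = dotv r q + dotv r (v - q) by rewrite dotvBr; ring.
have : dotv r (v - q) <= enorm r * e.
  apply: le_trans (dotv_le _ _) _; rewrite ler_wpM2l ?enorm_ge0//.
  by rewrite enormBC ltW.
rewrite /B; lra.
Qed.

End Distance.

(** * A priori estimates for the anti-windup system *)

Section AntiWindup.
Context {R : realType} {n : nat}.
Variables (Z : set 'cV[R]_n) (f : 'cV[R]_n -> 'cV[R]_n -> 'cV[R]_n)
  (G : 'cV[R]_n -> 'M[R]_n) (z0 : 'cV[R]_n) (M nu mu alpha eps : R).
Hypotheses (spdG : forall x, Z x -> spd (G x)) (Zz0 : Z z0).
Hypotheses (M0 : 0 < M) (nu0 : 0 < nu) (mu0 : 0 < mu).
Hypothesis bnd : forall z, cball z0 eps z -> Zalpha Z alpha z ->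
  forall p, projZ Z z p ->
  enorm (f z p) <= M /\ loewner_between mu nu (invmx (G p)).
Variables (K : R) (T : R) (z : R -> 'cV[R]_n).
Hypotheses (K0 : 0 < K) (Ksmall : K * M / mu < (2 * alpha)^-1).
Hypotheses (zz0 : z 0 = z0)
  (zball : forall t, 0 <= t -> t <= T -> enorm (z t - z0) <= eps)
  (solz : cara_sol setT (anti_windup Z f G K) T z).
Local Notation leb := (@lebesgue_measure R).
Local Notation r := (K * M / mu).

Let Z_nonempty : Z !=set0. Proof. by exists z0. Qed.

Let r0 : 0 < r. Proof. by rewrite divr_gt0 ?mulr_gt0. Qed.

(* With D = |z - p|, the penalty pushes towards Z at speed at least mu D / K and
   f pushes away at speed at most M. *)
Lemma anti_windup_inward t p : 0 <= t -> t <= T ->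
  projZ Z (z t) p -> r <= enorm (z t - p) -> enorm (z t - p) < (2 * alpha)^-1 ->
  dotv (z t - p) (f (z t) p - K^-1 *: (invmx (G p) *m (z t - p))) <= 0.
Proof.
move=> t0 tT pp rD Dalpha.
have [fM hA] : enorm (f (z t) p) <= M /\ loewner_between mu nu (invmx (G p)).
  by apply: bnd (pp); [exact: zball | exists p; split=> //; exact: pp.1].
rewrite dotvBr dotvZr dotv_qform.
set D := enorm (z t - p) in rD Dalpha *.
have D0 : 0 < D by apply: lt_le_trans r0 rD.
have h1 : dotv (z t - p) (f (z t) p) <= D * M.
  by apply: le_trans (dotv_le _ _) _; rewrite ler_wpM2l ?enorm_ge0.
have h2 : K^-1 * (mu * D ^+ 2) <= K^-1 * qform (invmx (G p)) (z t - p).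
  by rewrite ler_pM2l ?invr_gt0//; exact: (hA _).1.
have h3 : D * M <= K^-1 * (mu * D ^+ 2).
  rewrite mulrCA mulrC expr2 !mulrA ler_pM2r// -ler_pdivrMl ?mulr_gt0 ?invr_gt0//.
  by move: rD; rewrite invfM invrK; lra.
lra.
Qed.

Lemma clamp_diff_le (a b x y e : R) : a <= b -> 0 <= e ->
  y <= Num.max a x + e ->
  Num.min b (Num.max a y) <= Num.min b (Num.max a x) + e.
Proof.
move=> ab e0; rewrite /Num.min /Num.max.
case: (ltP a x) => ax; case: (ltP a y) => ay; case: ltP => ?; case: ltP => ?; lra.
Qed.

(** The inward estimate holds only between [r], below which the penalty need not win, and
    [(2 * alpha)^-1], where the assumed bounds stop. The distance clamped to this band cannot
    increase and starts at [r]; as [r] is strictly below the upper end, the distance never exceeds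
    [r]. *)
Lemma anti_windup_setdist_le t : 0 <= t -> t <= T -> setdist Z (z t) <= r.
Proof.
move=> t0 tT; have [acz dz] := solz.
pose h s := Num.min (2 * alpha)^-1 (Num.max r (setdist Z (z s))).
have rh := ltW Ksmall.
suff : h t <= h 0.
  have -> : h 0 = r.
    rewrite /h zz0 (setdist_projZ (projZ_self Zz0)) subrr enorm0.
    by rewrite (max_l (ltW r0)) min_r.
  rewrite /h; rewrite ge_min leNgt Ksmall /= ge_max => /andP[]//.
apply: (ac_nonincreasing t0).
  apply: (abs_cont_comp (C := 1) (C' := 0) acz) => // x y _ xy _.
  rewrite mul1r mul0r addr0.
  have e0 := enorm_ge0 (z y - z x).
  have h1 : h y <= h x + enorm (z y - z x).
    apply: clamp_diff_le => //; apply: le_trans (setdist_lipschitz (z y) (z x) Z_nonempty) _.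
    by rewrite lerD2r le_max lexx orbT.
  have h2 : h x <= h y + enorm (z y - z x).
    apply: clamp_diff_le => //; rewrite enormBC.
    apply: le_trans (setdist_lipschitz (z x) (z y) Z_nonempty) _.
    by rewrite lerD2r le_max lexx orbT.
  by rewrite ler_norml; apply/andP; split; lra.
apply: filterS dz; first exact: (ae_filter_ringOfSetsType leb).
move=> u /= hu; rewrite in_itv/= => /andP[u0 ut] e e0.
have [|du [[p [pp vE]] _]] := hu; first by rewrite in_itv/= u0 (le_trans ut tT).
have hmax x : h x <= (2 * alpha)^-1 by rewrite /h ge_min lexx.
have [rhoD|Drho] := leP (2 * alpha)^-1 (setdist Z (z u)).
  exists 1 => // s us _ _.
  have -> : h u = (2 * alpha)^-1 by rewrite /h min_l// le_max rhoD orbT.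
  have := hmax s; have : 0 <= e * (s - u) by rewrite mulr_ge0 ?subr_ge0 ?ltW.
  lra.
suff [d d0 hd] : exists2 d, 0 < d & forall s, u < s -> s < u + d ->
    setdist Z (z s) <= Num.max r (setdist Z (z u)) + e * (s - u).
  exists d => // s us sd _; rewrite lerBlDl; apply: clamp_diff_le => //.
    by rewrite mulr_ge0 ?subr_ge0 ?ltW.
  exact: hd.
set v := 'D_1 z u in vE.
have [Dr|rD] := ltP (setdist Z (z u)) r.
  have [d d0 hd] := derivable_expansion du ltr01.
  have v0 : 0 < enorm v + 1 by rewrite ltr_wpDl ?enorm_ge0.
  exists (Num.min d ((r - setdist Z (z u)) / (enorm v + 1))).
    by rewrite lt_min d0 divr_gt0 ?subr_gt0.
  move=> s us; rewrite -ltrBlDl lt_min => /andP[sd].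
  rewrite ltr_pdivlMr// => sr.
  have su : 0 <= s - u by rewrite subr_ge0 ltW.
  have := hd s; rewrite (ger0_norm su) -/v => /(_ sd); set q := _ - _ *: _ => qe.
  have := setdist_lipschitz (z s) (z u) Z_nonempty.
  have := enormD q ((s - u) *: v); rewrite subrK enormZ (ger0_norm su).
  have : 0 <= e * (s - u) by rewrite mulr_ge0// ltW.
  lra.
have DE := setdist_projZ pp; have [w wE] : exists w, w = z u - p by exists (z u - p).
rewrite -wE in DE; set D := setdist Z (z u) in DE Drho rD *.
have D0 : 0 < D by apply: lt_le_trans r0 rD.
have wv : dotv w v <= 0.
  rewrite vE wE; apply: anti_windup_inward => //; first exact: le_trans tT.
    by rewrite -wE -DE.
  by rewrite -wE -DE.
have e2 : 0 < e / 2 by rewrite divr_gt0.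
have [d d0 hd] := derivable_expansion du e2.
have v0 : 0 < enorm v ^+ 2 + 1 by rewrite ltr_wpDl ?sqr_ge0.
(* With tau = s - u, this makes tau^2 |v|^2 <= tau e D, so that |w + tau v|^2 <= D^2 + tau e D <= (D
   + tau e / 2)^2. The other half of [e] goes to the remainder [q]. *)
exists (Num.min d (e * D / (enorm v ^+ 2 + 1))).
  by rewrite lt_min d0 divr_gt0 ?mulr_gt0.
move=> s us; rewrite -ltrBlDl lt_min => /andP[sd].
rewrite ltr_pdivlMr// => sr.
have su : 0 < s - u by rewrite subr_gt0.
have := hd s; rewrite (gtr0_norm su) -/v => /(_ sd); set q := _ - _ *: _ => qe.
have h1 : enorm (w + (s - u) *: v) <= D + (s - u) * (e / 2).
  have e3 : 0 <= (s - u) * (e / 2) by rewrite mulr_ge0 ?ltW.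
  rewrite -(@ler_pXn2r _ 2)// ?nnegrE ?enorm_ge0 ?addr_ge0 ?(ltW D0)//.
  rewrite enorm_sqr dotvDl !dotvDr !dotvZl !dotvZr (dotvC v w) -!enorm_sqr -DE.
  have k1 : (s - u) * dotv w v <= 0 by rewrite mulr_ge0_le0// ltW.
  have k2 : (s - u) * ((s - u) * enorm v ^+ 2) <= (s - u) * (e * D).
    rewrite ler_pM2l//; lra.
  have := sqr_ge0 ((s - u) * (e / 2)); rewrite sqrrD; lra.
(* The projection [p] at time [u] is kept as competitor at time [s], so nothing is asked of
   projections at later times. *)
have := setdist_le (z s) pp.1.
have -> : z s - p = (w + (s - u) *: v) + q.
  by rewrite /q wE; apply/colP => i; rewrite !mxE; ring.
have := enormD (w + (s - u) *: v) q; lra.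
Qed.


(** The bound of [enorm_mulmx_loewner] for [invmx (G p)] applied to a vector of length at most
    [M / mu]; it does not involve [K]. *)
Definition slope_gap : R := n%:R * (nu * (1 + (M / mu) ^+ 2)).

(* What survives of the anti-windup equation in the limit K -> 0: up to the
   bounded factor [G p], the velocity defect is a normal vector of length at
   most [M / mu] at a point p of Z within distance rho of the curve. *)
Definition relaxed_solution (c C rho : R) (S : R) (y : R -> 'cV[R]_n) :=
  {ae leb, forall s, s \in `[0, S] -> derivable y s 1 /\
    exists p, [/\ Z p, enorm (y s - p) <= rho,
      enorm (f (y s) p - 'D_1 y s) <= C &
      forall v w, tangent_cone Z p w ->
        dotv (G p *m (f (y s) p - 'D_1 y s)) v <= c * enorm (v - w)]}.

Let velocity t p : 0 <= t -> t <= T -> projZ Z (z t) p ->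
  'D_1 z t = f (z t) p - K^-1 *: (invmx (G p) *m (z t - p)) ->
  [/\ enorm (z t - p) <= r, enorm (f (z t) p) <= M,
    enorm (f (z t) p - 'D_1 z t) <= slope_gap &
    forall v w, tangent_cone Z p w ->
      dotv (G p *m (f (z t) p - 'D_1 z t)) v <= M / mu * enorm (v - w)].
Proof.
move=> t0 tT pp DE.
have zr : enorm (z t - p) <= r by rewrite -(setdist_projZ pp) anti_windup_setdist_le.
have [fM hA] : enorm (f (z t) p) <= M /\ loewner_between mu nu (invmx (G p)).
  apply: bnd (pp); [exact: zball | exists p; split; [exact: pp.1|]].
  exact: le_lt_trans Ksmall.
have [sG pG] := spdG pp.1.
have uG := spd_unitmx (spdG pp.1).
pose eta := K^-1 *: (z t - p).
have fD : f (z t) p - 'D_1 z t = invmx (G p) *m eta.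
  by rewrite DE opprB addrC subrK /eta scalemxAr.
(* The radius [r] is proportional to [K], which cancels here; every later bound is uniform in [K]
   for this reason. *)
have etaM : enorm eta <= M / mu.
  rewrite enormZ gtr0_norm ?invr_gt0// ler_pdivrMl//.
  by apply: le_trans zr _; rewrite mulrA.
split=> //.
  rewrite fD; apply: le_trans (enorm_mulmx_loewner _ _ nu0 (ltW mu0) hA) _.
    by rewrite trmx_inv sG.
  rewrite /slope_gap ler_wpM2l// ler_pM2l// lerD2l.
  by apply: lerXn2r => //; rewrite nnegrE ?enorm_ge0// divr_ge0// ltW.
move=> v w Tw; rewrite fD mulKVmx//.
have -> : dotv eta v = dotv eta w + dotv eta (v - w) by rewrite dotvBr; ring.
have : dotv eta w <= 0.
  rewrite dotvZl; apply: mulr_ge0_le0; first by rewrite invr_ge0 ltW.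
  exact: (projZ_normal pp).
have := dotv_le eta (v - w).
have : enorm eta * enorm (v - w) <= M / mu * enorm (v - w).
  by rewrite ler_wpM2r ?enorm_ge0.
lra.
Qed.

Lemma anti_windup_relaxed : relaxed_solution (M / mu) slope_gap r T z.
Proof.
have [_ dz] := solz; apply: filterS dz; first exact: (ae_filter_ringOfSetsType leb).
move=> t /= h; rewrite in_itv/= => /andP[t0 tT].
have [|dt [[p [pp DE]] _]] := h; first by rewrite in_itv/= t0.
have [zr _ gap nrm] := velocity t0 tT pp DE.
by split=> //; exists p; split=> //; exact: pp.1.
Qed.

Lemma anti_windup_lipschitz s t : 0 <= s -> s <= t -> t <= T ->
  enorm (z t - z s) <= (M + slope_gap) * (t - s).
Proof.
have [acz dz] := solz.
have L0 : 0 <= M + slope_gap.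
  by rewrite addr_ge0 ?mulr_ge0 ?addr_ge0 ?sqr_ge0// ltW.
apply: (abs_cont_lipschitz L0 acz).
apply: filterS dz; first exact: (ae_filter_ringOfSetsType leb).
move=> u /= h; rewrite in_itv/= => /andP[u0 uT].
have [|dt [[p [pp DE]] _]] := h; first by rewrite in_itv/= u0.
have [_ fM gap _] := velocity u0 uT pp DE.
split=> //.
have := enormD (f (z u) p) ('D_1 z u - f (z u) p).
rewrite addrC subrK (enormBC ('D_1 z u)); lra.
Qed.

End AntiWindup.

(** * Passage to the limit in the normal inequality *)

Section RelaxedLimit.
Context {R : realType} {n : nat}.
Variables (Z : set 'cV[R]_n) (f : 'cV[R]_n -> 'cV[R]_n -> 'cV[R]_n)
  (G : 'cV[R]_n -> 'M[R]_n).
Hypotheses (clZ : clarke_regular Z) (spdG : forall x, Z x -> spd (G x)).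
Hypothesis cf : {within [set: 'cV[R]_n] `*` Z, continuous (fun q => f q.1 q.2)}.
Hypothesis cG : {within Z, continuous G}.
Local Notation leb := (@lebesgue_measure R).

Lemma within_modulus x : Z x -> forall e : R, 0 < e -> exists2 d, 0 < d &
  forall q y, Z y -> enorm (q - x) < d -> enorm (y - x) < d ->
    enorm (f q y - f x x) <= e /\ forall i j, `|(G x - G y) i j| <= e.
Proof.
move=> Zx e e0.
have /subspace_continuousP/(_ (x, x) (conj I Zx))/cvg_enorm/(_ _ e0) := cf.
rewrite near_withinE => /nbhs_ballP[d1 /= d10 h1].
have /subspace_continuousP/(_ x Zx)/cvgrPdist_lt/(_ _ e0) := cG.
rewrite near_withinE => /nbhs_ballP[d2 /= d20 h2].
exists (Num.min d1 d2); first by rewrite lt_min d10.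
move=> q y Zy; rewrite !lt_min => /andP[qd _] /andP[yd1 yd2].
have bl u (d : R) : enorm (u - x) < d -> ball x d u.
  by move=> ud; rewrite -ball_normE /= distrC; apply: le_lt_trans ud; exact: normr_le_enorm.
split; first by apply/ltW/(h1 (q, y)) => //; split; exact: bl.
move=> i j; apply: le_trans (ltW (h2 y (bl _ _ yd2) Zy)).
rewrite [leRHS]/Num.norm /= mx_normrE; apply/bigmax_geP; right => /=.
by exists (i, j).
Qed.

Lemma relaxed_limit_normal (c C : R) (rho : nat -> R) (S : nat -> R)
    (y : nat -> R -> 'cV[R]_n) (T t : R) (z : R -> 'cV[R]_n) (v : 'cV[R]_n) :
  0 <= c -> 0 <= C -> rho @ \oo --> 0 -> S @ \oo --> T ->
  (forall k, abs_cont 0 (S k) (y k)) ->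
  (forall k, relaxed_solution Z f G c C (rho k) (S k) (y k)) ->
  (forall e, 0 < e -> \forall k \near \oo,
     forall s, 0 <= s -> s <= S k -> enorm (y k s - z s) < e) ->
  0 <= t -> t < T -> derivable z t 1 -> Z (z t) -> tangent_cone Z (z t) v ->
  dotv (G (z t) *m (f (z t) (z t) - 'D_1 z t)) v <= 0.
Proof.
move=> c0 C0 rho0 ST acy rely yz t0 tT dz.
have [x xE] : exists x, x = z t by exists (z t).
have [D DE] : exists D, D = 'D_1 z t by exists ('D_1 z t).
rewrite -xE -DE => Zx Tv.
have [sG _] := spdG Zx; rewrite (dotv_symmetric _ _ sG) dotvC.
have [w wE] : exists w, w = G x *m v by exists (G x *m v).
(* Errors per unit of [e]: [c] for moving [v] to a tangent vector at [p], the middle term for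
   replacing [G p] by [G x], [enorm w] for replacing f(y, p) by f(x, x). The further [enorm w] in
   the bound is the error of the expansion of [z] at [t]. *)
rewrite -wE; pose B := c + n%:R * (n%:R * C) * enorm v + enorm w.
apply: (@le0_of_le_mul _ _ (B + enorm w)) => e e0 e1.
have [d1 [d10 hd1]] := clZ Zx Tv e0.
have [d2 d20 hd2] := within_modulus Zx e0.
have [d d0 [dd1 dd2]] : exists2 d, 0 < d & d <= d1 /\ d <= d2.
  by exists (Num.min d1 d2); rewrite ?lt_min ?d10// !ge_min !lexx orbT.
have [d3 d30 zd] := derivable_expansion dz e0.
have eD0 : 0 < e + enorm D by rewrite ltr_pwDl ?enorm_ge0.
(* Three constraints: the expansion of [z] is valid on [t, t + h], t + h lies strictly before [T]
   and so eventually below [S k], and [z] stays within d / 4 of [x]. *)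
pose h := Num.min (Num.min (d3 / 2) ((T - t) / 2)) (d / 4 / (e + enorm D)).
have h0 : 0 < h by rewrite !lt_min !divr_gt0 ?subr_gt0.
have hd3 : h < d3.
  have : h <= d3 / 2 by rewrite !ge_min lexx.
  lra.
have hT : t + h < T.
  have : h <= (T - t) / 2 by rewrite !ge_min lexx orbT.
  lra.
have hd : (e + enorm D) * h <= d / 4.
  by rewrite mulrC -ler_pdivlMr// ge_min lexx orbT.
have zh u : t <= u -> u <= t + h -> enorm (z u - x - (u - t) *: D) <= e * (u - t).
  move=> tu uh; have ut : 0 <= u - t by rewrite subr_ge0.
  by have := zd u; rewrite (ger0_norm ut) -xE -DE; apply; lra.
have zx u : t <= u -> u <= t + h -> enorm (z u - x) <= d / 4.
  move=> tu uh; have := zh u tu uh; set q := _ - _ *: _.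
  have ut : 0 <= u - t by rewrite subr_ge0.
  have := enormD q ((u - t) *: D); rewrite subrK enormZ (ger0_norm ut).
  have : (e + enorm D) * (u - t) <= (e + enorm D) * h by rewrite ler_pM2l//; lra.
  lra.
(* The limit in [k] is taken with [h] fixed: the endpoint error [e'] disappears before the
   inequality is divided by [h]. *)
have main : dotv (- w) (z (t + h) - x) <= (e * B - dotv w (f x x)) * h.
  apply/ler_addgt0Pr => e' e'0.
  pose e2 := Num.min (d / 4) (e' / (2 * (enorm w + 1))).
  have w0 : 0 < 2 * (enorm w + 1) by rewrite mulr_gt0// ltr_wpDl ?enorm_ge0.
  have e20 : 0 < e2 by rewrite lt_min !divr_gt0.
  have d40 : 0 < d / 4 by rewrite divr_gt0.
  have Th0 : 0 < T - (t + h) by rewrite subr_gt0.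
  move/cvgrPdist_lt: ST => /(_ _ Th0) SN.
  move/cvgrPdist_lt: rho0 => /(_ _ d40) rN.
  have [k [[]]] := filter_ex (filterI (filterI SN rN) (yz _ e20)).
  move=> /ltr_distlBl Sk; rewrite /= sub0r normrN => rk yk.
  have [rk0 rk'] : rho k < d / 4 /\ t + h <= S k.
    by split; [exact: le_lt_trans (ler_norm _) rk | lra].
  have ykd u : 0 <= u -> u <= S k -> enorm (y k u - z u) < d / 4.
    by move=> u0 uS; apply: lt_le_trans (yk u u0 uS) _; rewrite ge_min lexx.
  have : dotv (- w) (y k (t + h) - y k t) <= (e * B - dotv w (f x x)) * (t + h - t).
    apply: (abs_cont_dotv_le (acy k) t0) => //; first by rewrite lerDl ltW.
    apply: filterS (rely k); first exact: (ae_filter_ringOfSetsType leb).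
    move=> u /= hu tu uth; have u0 : 0 <= u by exact: le_trans tu.
    have uS : u <= S k by exact: le_trans rk'.
    have [|du [p [Zp pr pC pn]]] := hu; first by rewrite in_itv/= u0.
    split=> //; set Dy := 'D_1 (y k) u in pC pn *; set fp := f _ p in pC pn *.
    (* Distances of d / 4 each from [y k u] to [z u], from [z u] to [x], and from [p] to [y k u]
       keep [p] within d of [x]. *)
    have yx : enorm (y k u - x) < d / 2.
      have := enormB_triangle (z u) (y k u) x.
      have := ykd u u0 uS; have := zx u tu uth; lra.
    have px : enorm (p - x) < d.
      have := enormB_triangle (y k u) p x; rewrite (enormBC p (y k u)); lra.
    have [px1 px2] : enorm (p - x) < d1 /\ enorm (p - x) < d2 by split; lra.
    have yx2 : enorm (y k u - x) < d2 by lra.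
    have [w' [Tw' w'v]] := hd1 p Zp px1.
    have [ff GG] := hd2 _ _ Zp yx2 px2.
    have k1 := pn v w' Tw'.
    have k2 : c * enorm (v - w') <= c * e.
      by rewrite ler_wpM2l// enormBC ltW.
    have k3 : dotv w (f x x - fp) <= enorm w * e.
      by apply: le_trans (dotv_le _ _) _; rewrite ler_wpM2l ?enorm_ge0// enormBC.
    have k4 : dotv ((G x - G p) *m (fp - Dy)) v <= n%:R * (n%:R * C) * enorm v * e.
      apply: le_trans (dotv_le _ _) _; rewrite mulrAC ler_wpM2r ?enorm_ge0//.
      apply: le_trans (enorm_mulmx_le _ (ltW e0) GG) _.
      rewrite [leRHS](_ : _ = n%:R * (n%:R * e * C)); last by ring.
      by rewrite ler_wpM2l// ler_wpM2l// mulr_ge0// ltW.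
    have k5 : dotv w (fp - Dy) = dotv (G p *m (fp - Dy)) v + dotv ((G x - G p) *m (fp - Dy)) v.
      by rewrite mulmxBl dotvBl [RHS]addrC subrK (dotv_symmetric _ _ sG) -wE dotvC.
    move: k3 k5; rewrite /B !dotvBr dotvNl; lra.
  have -> : z (t + h) - x = (y k (t + h) - y k t) + (z (t + h) - y k (t + h)) + (y k t - x).
    by apply/colP => i; rewrite !mxE; ring.
  have tS : t <= S k by lra.
  have th0 : 0 <= t + h by lra.
  have j1 := ltW (yk _ th0 rk'); have j2 := ltW (yk _ t0 tS).
  have := dotv_le (- w) (z (t + h) - y k (t + h)).
  have := dotv_le (- w) (y k t - x).
  rewrite enormN (enormBC (z _)) xE => i1 i2.
  have i3 : enorm w * enorm (y k (t + h) - z (t + h)) <= enorm w * e2.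
    by rewrite ler_wpM2l ?enorm_ge0.
  have i4 : enorm w * enorm (y k t - z t) <= enorm w * e2.
    by rewrite ler_wpM2l ?enorm_ge0.
  have i5 : 2 * (enorm w + 1) * e2 <= e'.
    by rewrite mulrC -ler_pdivlMr// ge_min lexx orbT.
  move: i1 i2; rewrite !dotvDr [t + h - t]addrC addKr; lra.
have := zh (t + h); rewrite lexx lerDl (ltW h0) => /(_ isT isT).
rewrite [t + h - t]addrC addKr; set q := _ - _ *: _ => qe.
have : dotv (- w) (z (t + h) - x) = dotv (- w) q - h * dotv w D.
  by rewrite [dotv _ q]dotvBr dotvZr !dotvNl; ring.
have := normr_dotv_le w q; rewrite ler_norml => /andP[_ wq].
have wqe : enorm w * enorm q <= enorm w * (e * h) by rewrite ler_wpM2l ?enorm_ge0.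
move=> zE; rewrite -(ler_pM2l h0) [dotv w (f x x - D)]dotvBr.
move: main; rewrite zE dotvNl; lra.
Qed.

(** At an interior time the curve lies in [Z] on both sides, so its own points z(t + c d), with d
    tending to 0, witness tangency for either sign c. *)
Lemma derivable_tangent (T t c : R) (z : R -> 'cV[R]_n) :
  (forall s, 0 <= s -> s <= T -> Z (z s)) -> 0 < t -> t < T -> derivable z t 1 ->
  `|c| = 1 -> tangent_cone Z (z t) (c *: 'D_1 z t).
Proof.
move=> Zz t0 tT dz c1.
pose h := Num.min t (T - t).
have h0 : 0 < h by rewrite lt_min t0 subr_gt0.
pose d (k : nat) := h / k.+1%:R.
have d0 k : 0 < d k by rewrite divr_gt0.
have d_0 : d @ \oo --> 0.
  rewrite -[X in _ --> X](mulr0 h); apply: cvgMr.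
  exact: cvg_harmonic.
have dh k : d k <= h by rewrite ler_pdivrMr// ler_peMr ?(ltW h0)// ler1n.
have cd k : `|t + c * d k - t| = d k.
  by rewrite addrC addKr normrM c1 mul1r gtr0_norm.
have quot : (fun k => (d k)^-1 *: (z (t + c * d k) - z t)) @ \oo --> c *: 'D_1 z t.
  apply/cvg_enorm => e e0; have e2 : 0 < e / 2 by rewrite divr_gt0.
  have [r r0 zr] := derivable_expansion dz e2.
  have /cvgrPdist_lt/(_ _ r0) := d_0; apply: filterS => k.
  rewrite sub0r normrN gtr0_norm// => dr; have := zr (t + c * d k).
  rewrite cd => /(_ dr); rewrite [X in X *: _]addrC addKr => hk.
  rewrite [X in enorm X](_ : _ = (d k)^-1 *: (z (t + c * d k) - z t - (c * d k) *: 'D_1 z t)).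
    rewrite enormZ gtr0_norm ?invr_gt0//.
    apply: (@le_lt_trans _ _ (e / 2)); last lra.
    by rewrite ler_pdivrMl// [leRHS]mulrC.
  rewrite [RHS]scalerBr scalerA; congr (_ - _ *: _).
  by rewrite mulrCA mulVf ?mulr1// gt_eqF.
exists (fun k => z (t + c * d k)), d.
split; last (split; [exact: d0 | split; [exact: d_0 | split; [|exact: quot]]]).
  move=> k; have := dh k; rewrite le_min => /andP[dt dT].
  have : `|c * d k| <= d k by rewrite normrM c1 mul1r gtr0_norm.
  by rewrite ler_norml => /andP[? ?]; apply: Zz; lra.
apply/cvg_enorm => e e0.
have [r r0 zr] := derivable_expansion dz ltr01.
have L0 : 0 < 1 + enorm ('D_1 z t) by rewrite ltr_pwDl ?enorm_ge0.
have e1 : 0 < e / (1 + enorm ('D_1 z t)) by rewrite divr_gt0.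
have /cvgrPdist_lt/(_ _ r0) := d_0; have /cvgrPdist_lt/(_ _ e1) := d_0.
apply: filterS2 => k.
rewrite sub0r normrN gtr0_norm// ltr_pdivlMr// => de dr; have := zr (t + c * d k); rewrite cd => /(_ dr).
set q := _ - _ *: _ => qd; have := enormD q ((t + c * d k - t) *: 'D_1 z t).
rewrite subrK enormZ cd; lra.
Qed.

(** Expand q(u - w) around v - w: the cross term is 2(-<G(w - v), u> + <G(w - v), v>). Its first
    part is nonnegative by normality against u, its second by normality against -v. *)
Lemma normal_proj_op x v w : spd (G x) -> tangent_cone Z x v ->
  tangent_cone Z x (- v) ->
  (forall u, tangent_cone Z x u -> dotv (G x *m (w - v)) u <= 0) ->
  proj_op Z G w x v.
Proof.
move=> [sG pG] Tv TNv h; split=> // u Tu; apply: ler_wsqrtr.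
have q0 a : 0 <= qform (G x) a.
  have [->|a0] := eqVneq a 0; last exact/ltW/pG.
  by rewrite -dotv_qform mulmx0 /dotv big1// => i _; rewrite mxE mul0r.
have -> : u - w = (v - w) + (u - v) by rewrite [RHS]addrC addrA subrK.
rewrite (qformD (v - w) (u - v) sG) -dotv_symmetric//.
have := h _ Tu; have := h _ TNv; rewrite dotvNr -(opprB v w) mulmxN !dotvNl.
have := q0 (u - v); rewrite dotvBr; lra.
Qed.

End RelaxedLimit.

(** * Compactness of equi-Lipschitz curves with varying end times *)

Section EquiLipschitzExtraction.
Context {R : realType}.
Implicit Types (a b s t e : R).

(** The limit is the supremum of the levels that [x] exceeds on a set of [U]; a level above it fails
    on a set of [U] because [U] decides every set. *)
Lemma ultra_limit (U : set_system nat) (x : nat -> R) B : UltraFilter U ->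
  (forall k, `|x k| <= B) -> exists l, forall e, 0 < e -> U [set k | `|x k - l| < e].
Proof.
move=> uU xB; have fU : Filter U := @filter_filter _ _ (ultra_proper (UltraFilter := uU)).
pose A := [set a | U [set k | a <= x k]].
have xB' k : - B <= x k <= B by rewrite -ler_norml.
have AB : A (- B).
  by apply: (@filterS _ _ _ setT); [move=> k _ /=; have /andP[] := xB' k|exact: filterT].
have ubA : has_ubound A.
  exists B => a Aa; have [k /= ak] := @filter_ex _ _ (ultra_proper (UltraFilter := uU)) _ Aa.
  by apply: le_trans ak _; have /andP[] := xB' k.
exists (sup A) => e e0.
have [|a Aa al] := @sup_gt _ A (sup A - e) (ex_intro _ _ AB).
  by rewrite ltrBlDr ltrDl.
have nA : U (~` [set k | sup A + e / 2 <= x k]).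
  have [/(ub_le_sup ubA)|//] := in_ultra_setVsetC [set k | sup A + e / 2 <= x k] uU.
  lra.
apply: filterS2 Aa nA => k /= ak /negP; rewrite -ltNge => kl.
by rewrite ltr_norml; apply/andP; split; lra.
Qed.

(** Extends a curve given on [0, a] to the whole line by constants, which preserves its Lipschitz
    constant and gives all curves a common domain. *)
Definition clamp a t : R := Num.max 0 (Num.min a t).

Lemma clamp_itv a t : 0 <= a -> 0 <= clamp a t <= a.
Proof. by move=> a0; rewrite /clamp le_max lexx /= ge_max a0 ge_min lexx. Qed.

Lemma clamp_id a t : 0 <= t -> t <= a -> clamp a t = t.
Proof. by move=> t0 ta; rewrite /clamp min_r// max_r. Qed.

Lemma clamp_lipschitz a s t : 0 <= a -> s <= t ->
  0 <= clamp a t - clamp a s <= t - s.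
Proof.
move=> a0 st; rewrite /clamp /Num.max /Num.min.
by apply/andP; case: (ltP a s) => ?; case: (ltP a t) => ?; case: ltP => ?; case: ltP => ?; split; lra.
Qed.

Context {n : nat}.

(** An Arzela-Ascoli argument in which one ultrafilter finer than [\oo] yields the limits at all
    times, and of the end times, at once. A subsequence is chosen only after uniformity is known. *)
Lemma equilipschitz_extraction (y : nat -> R -> 'cV[R]_n) (S : nat -> R)
    (T L B : R) (x0 : 'cV[R]_n) : 0 <= L ->
  (forall k, 0 <= S k /\ S k <= T) ->
  (forall k s t, 0 <= s -> s <= t -> t <= S k ->
     enorm (y k t - y k s) <= L * (t - s)) ->
  (forall k t, 0 <= t -> t <= S k -> enorm (y k t - x0) <= B) ->
  exists phi : nat -> nat, (forall k, (phi k < phi k.+1)%N) /\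
  exists (T' : R) (z : R -> 'cV[R]_n),
    [/\ S \o phi @ \oo --> T',
        forall s t, s <= t -> enorm (z t - z s) <= L * (t - s) &
        forall e, 0 < e -> \forall k \near \oo, forall s, 0 <= s -> s <= S (phi k) ->
          enorm (y (phi k) s - z s) < e].
Proof.
move=> L0 ST yL yB.
have [U [uU oU]] := @ultraFilterLemma nat \oo _.
have pU := ultra_proper (UltraFilter := uU).
have fU : Filter U := @filter_filter _ _ pU.
pose Y k t := y k (clamp (S k) t).
have Sk0 k : 0 <= S k := (ST k).1.
have YL k s t : s <= t -> enorm (Y k t - Y k s) <= L * (t - s).
  move=> st; have /andP[c0 cts] := clamp_lipschitz (Sk0 k) st.
  have /andP[? ?] := clamp_itv s (Sk0 k); have /andP[? ?] := clamp_itv t (Sk0 k).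
  apply: le_trans (yL _ _ _ _ _ _) _ => //; first by rewrite -subr_ge0.
  by rewrite ler_wpM2l.
have [T' T'E] : exists l, forall e, 0 < e -> U [set k | `|S k - l| < e].
  apply: (@ultra_limit _ _ T uU) => k; rewrite ger0_norm//; exact: (ST k).2.
have lim_coord t i : exists l, forall e, 0 < e -> U [set k | `|Y k t i 0 - l| < e].
  apply: (@ultra_limit _ _ (B + enorm x0) uU) => k.
  have /andP[c0 cS] := clamp_itv t (Sk0 k).
  have := yB k _ c0 cS; have := enormD (Y k t - x0) x0; rewrite subrK.
  have := normr_coord_le_enorm (Y k t) i; rewrite /Y; lra.
pose z t : 'cV[R]_n := \col_i sval (cid (lim_coord t i)).
have zE t e : 0 < e -> U [set k | enorm (Y k t - z t) < e].
  move: e; apply/(cvg_enorm (F := U) (fun k => Y k t) (z t)).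
  apply/cvgrPdist_lt => e e0.
  have : U [set k | forall i, `|Y k t i 0 - z t i 0| < e / 2].
    apply: filter_forall => i; rewrite /z mxE.
    by case: cid => l /= hl; apply: hl; rewrite divr_gt0.
  apply: filterS => k hk; rewrite distrC.
  apply: (@le_lt_trans _ _ (e / 2)); last lra.
  apply: normr_le_coord; first by rewrite divr_ge0// ltW.
  by move=> i; have := hk i; rewrite !mxE => /ltW.
have zL s t : s <= t -> enorm (z t - z s) <= L * (t - s).
  move=> st; apply/ler_addgt0Pr => e e0; have e2 : 0 < e / 2 by rewrite divr_gt0.
  have [k [/= k1 k2]] := @filter_ex _ _ pU _ (filterI (zE s _ e2) (zE t _ e2)).
  have := YL k _ _ st; have := enormB_triangle (Y k t) (z t) (z s).
  have := enormB_triangle (Y k s) (Y k t) (z s).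
  rewrite (enormBC (z t) (Y k t)); lra.
(* Induction over a grid of mesh [h]: the error is below [e] at each grid point, and within a cell
   each of the two curves moves by at most [L * h]. *)
have unif e h m : 0 < e -> 0 <= h ->
    U [set k | forall t, 0 <= t -> t <= h * m%:R -> enorm (Y k t - z t) < e + 2 * (L * h)].
  move=> e0 h0; have Lh : 0 <= L * h by rewrite mulr_ge0.
  elim: m => [|m IH].
    apply: filterS (zE 0 _ e0) => k /= hk t t0; rewrite mulr0 => t0'.
    have -> : t = 0 by apply/eqP; rewrite eq_le t0 t0'.
    lra.
  apply: filterS2 IH (zE (h * m%:R) _ e0) => k /= IH hk t t0.
  have [tm _|mt tm] := leP t (h * m%:R); first exact: IH.
  have tmh : t - h * m%:R <= h by move: tm; rewrite -natr1 mulrDr mulr1; lra.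
  have := YL k _ _ (ltW mt); have := zL _ _ (ltW mt).
  have : L * (t - h * m%:R) <= L * h by rewrite ler_wpM2l.
  have := enormB_triangle (Y k (h * m%:R)) (Y k t) (z t).
  have := enormB_triangle (z (h * m%:R)) (Y k (h * m%:R)) (z t).
  rewrite (enormBC (z _) (z t)); lra.
have {unif}unif e : 0 < e ->
    U [set k | (forall t, 0 <= t -> t <= S k -> enorm (y k t - z t) < e) /\ `|S k - T'| < e].
  move=> e0; pose h := e / (4 * (L + 1)).
  have h0 : 0 < h by rewrite divr_gt0// mulr_gt0// ltr_wpDl.
  have e2 : 0 < e / 2 by rewrite divr_gt0.
  have Lh : 2 * (L * h) < e / 2.
    have : L * h < (L + 1) * h by rewrite ltr_pM2r// ltrDl.
    have -> : (L + 1) * h = e / 4 by rewrite /h; field; rewrite gt_eqF// ltr_wpDl.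
    lra.
  have [m Tm] : exists m : nat, T <= h * m%:R.
    exists (Num.truncn (T / h)).+1; rewrite mulrC -ler_pdivrMr//.
    by apply/ltW; rewrite truncnS_gt.
  apply: filterS2 (unif _ _ m e2 (ltW h0)) (T'E _ e0) => k /= h1 h2; split=> // t t0 tS.
  have := h1 t t0 (le_trans tS (le_trans (ST k).2 Tm)).
  rewrite /Y clamp_id//; lra.
have ex (jN : nat * nat) : exists k, (jN.2 <= k)%N /\
    ((forall t, 0 <= t -> t <= S k -> enorm (y k t - z t) < jN.1.+1%:R^-1) /\
     `|S k - T'| < jN.1.+1%:R^-1).
  have j0 : 0 < (jN.1.+1%:R^-1 : R) by rewrite invr_gt0.
  have UN : U [set k | (jN.2 <= k)%N] by apply: oU; exact: nbhs_infty_ge.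
  have [k [/= ? ?]] := @filter_ex _ _ pU _ (filterI UN (unif _ j0)).
  by exists k.
have [pick pickP] := choice ex.
(* The first component of the argument of [pick] sets the tolerance, the second the least admissible
   index; the successor there makes [phi] strictly increasing. *)
pose phi := fix phi k := if k is k'.+1 then pick (k, (phi k').+1) else pick (0%N, 0%N).
have phiP k : (forall t, 0 <= t -> t <= S (phi k) -> enorm (y (phi k) t - z t) < k.+1%:R^-1) /\
     `|S (phi k) - T'| < k.+1%:R^-1.
  by case: k => [|k] /=; [have [] := pickP (0%N, 0%N) | have [] := pickP (k.+1, (phi k).+1)].
exists phi; split; first by move=> k; have [] := pickP (k.+1, (phi k).+1).
exists T', z; split=> //.
  apply/cvgrPdist_lt => e e0; near=> k; rewrite /= distrC.
  apply: lt_trans (phiP k).2 _; near: k; exact: near_infty_natSinv_lt (PosNum e0).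
move=> e e0; near=> k => s s0 sS; apply: lt_trans ((phiP k).1 s s0 sS) _.
near: k; exact: near_infty_natSinv_lt (PosNum e0).
Unshelve. all: by end_near. Qed.

End EquiLipschitzExtraction.

(** * Regularity of Lipschitz curves *)

Section LipschitzCurves.
Context {R : realType} {n : nat}.
Variables (L : R) (z : R -> 'cV[R]_n).
Hypothesis L0 : 0 <= L.
Hypothesis zL : forall s t, s <= t -> enorm (z t - z s) <= L * (t - s).
Local Notation leb := (@lebesgue_measure R).

Lemma lipschitz_abs_cont (a b : R) : abs_cont a b z.
Proof.
move=> e e0; have L1 : 0 < L + 1 by rewrite ltr_wpDl.
exists (e / (L + 1)); split; first by rewrite divr_gt0.
move=> k l r lr _; rewrite ltr_pdivlMr// => se.
apply: (@le_lt_trans _ _ (\sum_(i < k) L * (r i - l i))).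
  by apply: ler_sum => i _; apply: zL; have [_ []] := lr i (ltn_ord i).
rewrite -mulr_sumr.
have : 0 <= \sum_(i < k) (r i - l i).
  by apply: sumr_ge0 => i _; rewrite subr_ge0; have [_ []] := lr i (ltn_ord i).
lra.
Qed.

Lemma lipschitz_curve_derivable_ae (a b : R) : a < b ->
  {ae leb, forall t, a < t < b -> derivable z t 1}.
Proof.
move=> ab.
have aeF := ae_filter_ringOfSetsType leb.
have : {ae leb, forall t, forall i, a < t < b -> derivable (fun s => z s i 0) t 1}.
  apply: filter_forall => i; apply: (@lipschitz_derivable_ae _ (L + 1)) => //.
    by rewrite ltr_wpDl.
  move=> s t st; apply: (@le_trans _ _ (enorm (z t - z s))).
    by have := normr_coord_le_enorm (z t - z s) i; rewrite !mxE.
  apply: le_trans (zL st) _; rewrite ler_wpM2r ?subr_ge0// lerDl//.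
by apply: filterS => t h tab; apply/derivable_mxP => i j; rewrite ord1; exact: h.
Qed.

End LipschitzCurves.

(** * Assembly of the limit solution and graphical convergence *)

Lemma ae_neq {R : realType} (a : R) : {ae (@lebesgue_measure R), forall t, t != a}.
Proof.
exists [set a]; split; [by []|exact: lebesgue_measure_set1|].
by move=> t /= /negP; rewrite negbK => /eqP.
Qed.

Theorem theorem4p5 (R : realType) (n : nat) (Z : set 'cV[R]_n)
  (f : 'cV[R]_n -> 'cV[R]_n -> 'cV[R]_n) (G : 'cV[R]_n -> 'M[R]_n)
  (z0 : 'cV[R]_n) (M nu mu alpha eps : R) :
  closed Z -> clarke_regular Z ->
  {within [set: 'cV[R]_n] `*` Z, continuous (fun q => f q.1 q.2)} ->
  {within Z, continuous G} ->
  (forall x, Z x -> spd (G x)) ->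
  Z z0 -> 0 < M -> 0 < nu -> 0 < mu -> 0 < alpha -> 0 < eps ->
  (forall z, cball z0 eps z -> Zalpha Z alpha z -> forall p, projZ Z z p ->
     enorm (f z p) <= M /\ loewner_between mu nu (invmx (G p))) ->
  (forall z, cball z0 eps z -> Z z -> prox_regular_at Z alpha z) ->
  forall T : R, 0 < T ->
  forall K : nat -> R, (forall k, 0 < K k) -> K @ \oo --> (0 : R) ->
  forall (Tn : nat -> R) (zn : nat -> R -> 'cV[R]_n),
  (forall k, truncated_sol T eps z0 setT (anti_windup Z f G (K k)) (Tn k) (zn k)) ->
  exists phi : nat -> nat, (forall k, (phi k < phi k.+1)%N) /\
  exists (T' : R) (z : R -> 'cV[R]_n),
    truncated_sol T eps z0 Z (pds_rhs Z f G) T' z /\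
    pk_conv (fun k => graph (Tn (phi k)) (zn (phi k))) (graph T' z).
Proof.
move=> cZ clZ cf cG spdG Zz0 M0 nu0 mu0 alpha0 eps0 bnd _ T T0 K K0 K_0 Tn zn sol.
have Zn0 : Z !=set0 by exists z0.
have rho0 : 0 < (2 * alpha)^-1 by rewrite invr_gt0 mulr_gt0.
pose L := M + @slope_gap R n M nu mu.
have gap0 : 0 <= @slope_gap R n M nu mu.
  by rewrite mulr_ge0// mulr_ge0 ?(ltW nu0)// addr_ge0// sqr_ge0.
have L0 : 0 <= L by rewrite addr_ge0 ?(ltW M0).
have r_0 : (fun k => K k * M / mu) @ \oo --> 0.
  by rewrite -[X in _ --> X](mul0r (M / mu)); under eq_fun do rewrite -mulrA; exact: cvgMl.
(* The a priori estimates require the radius to be below [(2 * alpha)^-1], so finitely many initial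
   curves are dropped; the final subsequence is shifted by [N]. *)
have [N _ hN] : \forall k \near \oo, K k * M / mu < (2 * alpha)^-1.
  move/cvgrPdist_lt: r_0 => /(_ _ rho0); apply: filterS => k.
  by rewrite sub0r normrN; apply: le_lt_trans; exact: ler_norm.
have KN k : K (N + k)%N * M / mu < (2 * alpha)^-1 by apply: hN; rewrite /= leq_addr.
have solN k := sol (N + k)%N.
pose y k := zn (N + k)%N; pose S k := Tn (N + k)%N.
have ST k : 0 <= S k /\ S k <= T by have [? [? _]] := solN k.
have y0 k : y k 0 = z0 by have [_ [_ [? _]]] := solN k.
have ysol k : cara_sol setT (anti_windup Z f G (K (N + k)%N)) (S k) (y k).
  by have [_ [_ [_ [? _]]]] := solN k.
have yball k t : 0 <= t -> t <= S k -> enorm (y k t - z0) <= eps.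
  by have [_ [_ [_ [_ [h _]]]]] := solN k; exact: h.
have yend k : S k = T \/ enorm (y k (S k) - z0) = eps.
  by have [_ [_ [_ [_ [_ ?]]]]] := solN k.
have yL k s t := @anti_windup_lipschitz _ _ _ _ _ _ _ _ _ _ _ spdG Zz0 M0 nu0 mu0 bnd
  _ _ _ (K0 _) (KN k) (y0 k) (yball k) (ysol k) s t.
have yrel k := anti_windup_relaxed spdG Zz0 M0 nu0 mu0 bnd
  (K0 _) (KN k) (y0 k) (yball k) (ysol k).
have ydist k t := @anti_windup_setdist_le _ _ _ _ _ _ _ _ _ _ _ Zz0 M0 mu0 bnd
  _ _ _ (K0 _) (KN k) (y0 k) (yball k) (ysol k) t.
have [phi [phi_lt [T' [z [SphiT zL yz]]]]] := equilipschitz_extraction L0 ST yL yball.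
exists (fun k => (N + phi k)%N); split; first by move=> k; rewrite ltn_add2l.
exists T', z.
have phi_ge k : (k <= phi k)%N.
  by elim: k => // k IH; apply: leq_ltn_trans IH (phi_lt k).
have rphi_0 : (fun k => K (N + phi k)%N * M / mu) @ \oo --> 0.
  apply/cvgrPdist_lt => e e0; move/cvgrPdist_lt: r_0 => /(_ _ e0)[N1 _ h1].
  exists N1 => // k /= N1k; apply: h1 => /=.
  by apply: leq_trans N1k _; apply: leq_trans (phi_ge k) _; rewrite leq_addl.
have SE e : 0 < e -> \forall k \near \oo, `|T' - S (phi k)| < e.
  by move=> e0; move/cvgrPdist_lt: SphiT => /(_ _ e0).
have zL' s t : enorm (z t - z s) <= L * `|t - s|.
  have [st|/ltW ts] := leP s t; first by rewrite ger0_norm ?subr_ge0//; exact: zL.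
  by rewrite enormBC distrC ger0_norm ?subr_ge0//; exact: zL.
have T'0 : 0 <= T'.
  apply/ler_addgt0Pr => e e0; have [k kT] := filter_ex (SE _ e0).
  by have := ltr_distlBl kT; have [] := ST (phi k); move: kT; rewrite ltr_norml => /andP[]; lra.
have T'T : T' <= T.
  apply/ler_addgt0Pr => e e0; have [k kT] := filter_ex (SE _ e0).
  by have := ltr_distlDr kT; have [] := ST (phi k); lra.
(* A time t <= T' may lie beyond the end of an approximating curve; it is then replaced by that end
   time, which tends to T'. *)
have approx t e : 0 <= t -> t <= T' -> 0 < e -> \forall k \near \oo,
    let s := Num.min t (S (phi k)) in
    [/\ 0 <= s, s <= S (phi k), `|t - s| < e & enorm (y (phi k) s - z t) < e].
  move=> t0 tT' e0; have e2 : 0 < e / 2 by rewrite divr_gt0.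
  have eL : 0 < e / (2 * (L + 1)) by rewrite divr_gt0// mulr_gt0// ltr_wpDl.
  apply: filterS3 (SE _ e0) (SE _ eL) (yz _ e2) => k S1 S2 yk.
  set s := Num.min _ _.
  have s0 : 0 <= s by rewrite le_min t0; have [] := ST (phi k).
  have sS : s <= S (phi k) by rewrite ge_min lexx orbT.
  have ts : `|t - s| <= `|T' - S (phi k)|.
    rewrite /s; case: (leP t (S (phi k))) => [_|St]; first by rewrite subrr normr0.
    by rewrite !ger0_norm ?subr_ge0 ?(ltW St)// ?(le_trans (ltW St) tT')// lerD2r.
  split=> //; first exact: le_lt_trans S1.
  have := enormB_triangle (z s) (y (phi k) s) (z t); have := yk _ s0 sS.
  have := zL' t s; rewrite (distrC s t).
  have : L * `|t - s| <= L * `|T' - S (phi k)| by rewrite ler_wpM2l.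
  move: S2; rewrite ltr_pdivlMr ?mulr_gt0 ?ltr_wpDl// => S2.
  have := normr_ge0 (T' - S (phi k)); lra.
have zZ t : 0 <= t -> t <= T' -> Z (z t).
  move=> t0 tT'; apply: setdist_closed => //.
  apply/ler_addgt0Pr => e e0; rewrite add0r; have e2 : 0 < e / 2 by rewrite divr_gt0.
  move/cvgrPdist_lt: rphi_0 => /(_ _ e2) re.
  have [k [[s0 sS _ ys]]] := filter_ex (filterI (approx t _ t0 tT' e2) re).
  rewrite /= sub0r normrN => rk; have := ydist _ _ s0 sS.
  have := ler_norm (K (N + phi k)%N * M / mu).
  have := setdist_lipschitz (z t) (y (phi k) (Num.min t (S (phi k)))) Zn0.
  rewrite enormBC; lra.
have z0E : z 0 = z0.
  apply/eqP; rewrite -subr_eq0; apply/eqP/enorm_eq0/eqP.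
  rewrite eq_le enorm_ge0 andbT; apply/ler_addgt0Pr => e e0.
  have [k h] := filter_ex (yz _ e0).
  by have := h 0 (lexx _) (ST _).1; rewrite y0 enormBC add0r => /ltW.
have zball t : 0 <= t -> t <= T' -> enorm (z t - z0) <= eps.
  move=> t0 tT'; apply/ler_addgt0Pr => e e0.
  have [k [s0 sS _ ys]] := filter_ex (approx t _ t0 tT' e0).
  have := yball _ _ s0 sS.
  have := enormB_triangle (y (phi k) (Num.min t (S (phi k)))) (z t) z0.
  rewrite (enormBC (z t) (y _ _)); lra.
have leb_filter := ae_filter_ringOfSetsType (@lebesgue_measure R).
split.
  do 3 (split; first by []); split; last first.
    split=> //; have [->|T'neq] := eqVneq T' T; [by left|right].
    (* Curves ending close enough to T' end before [T], hence on the sphere of radius [eps], and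
       this passes to the limit. *)
    have T'lt : T' < T by rewrite lt_neqAle T'neq.
    have dT : 0 < T - T' by rewrite subr_gt0.
    apply/eqP; rewrite -subr_eq0 -normr_le0; apply/ler_addgt0Pr => e e0.
    have eL : 0 < e / (2 * (L + 1)) by rewrite divr_gt0// mulr_gt0// ltr_wpDl.
    have e2 : 0 < e / 2 by rewrite divr_gt0.
    have [k [[S1 S2] yk]] := filter_ex (filterI (filterI (SE _ dT) (SE _ eL)) (yz _ e2)).
    have [Sk0 _] := ST (phi k); have ykS := yk _ Sk0 (lexx _).
    have [SkT|yeps] := yend (phi k).
      by move: S1; rewrite SkT distrC ger0_norm ?ltxx// ltW.
    have b1 := enormB_triangle (z (S (phi k))) (z T') (y (phi k) (S (phi k))).
    have b2 := enormB_triangle (y (phi k) (S (phi k))) (z T') z0.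
    have b3 := enormB_triangle (z T') (y (phi k) (S (phi k))) z0.
    have b4 := zL' (S (phi k)) T'.
    rewrite (enormBC (z (S _))) in b1; rewrite (enormBC (y _ _) (z T')) yeps in b3.
    rewrite yeps in b2.
    move: S2; rewrite ltr_pdivlMr ?mulr_gt0 ?ltr_wpDl// => S2.
    have := normr_ge0 (T' - S (phi k)).
    rewrite add0r ler_norml => n0; apply/andP; split; lra.
  split; first exact: lipschitz_abs_cont L0 zL _ _.
  (* [z] is Lipschitz on the whole line, so an interval larger than [0, T'] may be used; it is
     nondegenerate even if T' = 0. *)
  have dz := lipschitz_curve_derivable_ae L0 zL (_ : -1 < T' + 1).
  have {}dz := dz ltac:(lra).
  (* The endpoints are discarded because tangency of both velocities needs points of [Z] on either
     side of t. *)
  apply: filterS3 dz (ae_neq 0) (ae_neq T') => t dzt tn0 tnT'; rewrite in_itv/= => /andP[t0 tT'].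
  have {}tn0 : 0 < t by rewrite lt_neqAle eq_sym tn0.
  have {}tnT' : t < T' by rewrite lt_neqAle tnT'.
  have {}dzt : derivable z t 1 by apply: dzt; apply/andP; split; lra.
  have Zt := zZ t t0 tT'.
  split=> //; split=> //; exists (z t); split; first exact: projZ_self.
  have tang c := derivable_tangent zZ tn0 tnT' dzt (c := c).
  apply: normal_proj_op; first exact: spdG.
  - by rewrite -[X in tangent_cone _ _ X]scale1r; apply: tang; rewrite normr1.
  - by rewrite -scaleN1r; apply: tang; rewrite normrN1.
  - move=> u Tu; apply: (relaxed_limit_normal clZ spdG cf cG (c := M / mu) (C := @slope_gap R n M nu mu) (S := S \o phi)
      (y := y \o phi) (T := T') _ _ rphi_0 SphiT) => //.
    + by rewrite divr_ge0 ?ltW.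
    + by move=> k; have [] := ysol (phi k).
have sup_le : pk_limsup (fun k => graph (Tn (N + phi k)%N) (zn (N + phi k)%N)) `<=` graph T' z.
  move=> [t x] h.
  have near_q e : 0 < e -> exists k s, [/\ 0 <= s, s <= S (phi k), `|t - s| < e,
      enorm (x - z s) < e & `|T' - S (phi k)| < e].
    move=> e0; have e2 : 0 < e / 2 by rewrite divr_gt0.
    have [N1 _ h1] := filterI (SE _ e2) (yz _ e2).
    have [k [N1k [[s w] [[/= s0 [sS wE]] sw]]]] := h _ e2 N1.
    have [Sk yk] := h1 k N1k; exists k, s; move: sw; rewrite /pdist /= => sw.
    have := enorm_ge0 (x - w); have := normr_ge0 (t - s) => n0 n1.
    have := yk s s0 sS; rewrite -[y _ s]wE => wz.
    have := enormB_triangle w x (z s) => tr.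
    by split=> //; [lra|lra|lra].
  have t0 : 0 <= t.
    apply/ler_addgt0Pr => e e0; have [k [s [s0 sS ts _ _]]] := near_q e e0.
    by move: ts; rewrite ltr_norml => /andP[]; lra.
  have tT' : t <= T'.
    apply/ler_addgt0Pr => e e0; have e2 : 0 < e / 2 by rewrite divr_gt0.
    have [k [s [s0 sS ts _ Sk]]] := near_q _ e2.
    by move: ts Sk; rewrite !ltr_norml => /andP[? ?] /andP[? ?]; lra.
  split=> //; split=> //=; apply/eqP; rewrite -subr_eq0; apply/eqP/enorm_eq0/eqP.
  rewrite eq_le enorm_ge0 andbT; apply/ler_addgt0Pr => e e0; rewrite add0r.
  pose d := e / (L + 1); have L1 : 0 < L + 1 by rewrite ltr_wpDl.
  have dE : d + L * d = e by rewrite /d; field; rewrite gt_eqF.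
  have [|k [s [s0 sS ts xz _]]] := near_q d; first by rewrite divr_gt0.
  have Lts : L * `|t - s| <= L * d by rewrite ler_wpM2l// ltW.
  have := enormB_triangle (z s) x (z t); have := zL' t s; rewrite (distrC s).
  lra.
have inf_ge : graph T' z `<=` pk_liminf (fun k => graph (Tn (N + phi k)%N) (zn (N + phi k)%N)).
  move=> [t x] [/= t0 [tT' ->]] e e0; have e2 : 0 < e / 2 by rewrite divr_gt0.
  have [N1 _ h1] := approx t _ t0 tT' e2; exists N1 => k /h1 [s0 sS ts ys].
  exists (Num.min t (S (phi k)), y (phi k) (Num.min t (S (phi k)))); split=> //.
  by rewrite /pdist /= (enormBC (z t)); lra.
have inf_sup : pk_liminf (fun k => graph (Tn (N + phi k)%N) (zn (N + phi k)%N)) `<=`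
    pk_limsup (fun k => graph (Tn (N + phi k)%N) (zn (N + phi k)%N)).
  move=> q h e e0 N1; have [N2 h2] := h e e0; exists (maxn N1 N2).
  by split; [exact: leq_maxl|apply: h2; exact: leq_maxr].
(* The inclusions close a cycle: lower limit, upper limit, graph, lower limit. *)
by split; apply/seteqP; split=> //; [exact: subset_trans sup_le|exact: subset_trans inf_sup].
Qed.
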